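(* Let $(R,\mathfrak{m})$ be a regular local ring of characteristic $p>0$ and let $f\in\mathfrak{m}$. Then the generating function $G_f(z)=\sum_{e\geqslant0}\mu_f(p^e)z^e$ is a rational function of $z$ with a simple pole at $z=1/p$, and \[\mathrm{fpt}(f)=\lim_{z\to 1/p}(1-pz)\,G_f(z).\]
   Context: For $q=p^e$, $\mathfrak{m}^{[q]}$ is the ideal generated by $\{r^q: r\in\mathfrak{m}\}$, and $\mu_f(q)=\min\{k\in\mathbf{N}: f^k\in\mathfrak{m}^{[q]}\}$. The sequence $\mu_f(p^e)/p^e$ ($e\geqslant0$) is non-increasing, and its limit is the $F$-pure threshold $\mathrm{fpt}(f)$.
   Formalization: The formal theorem assumes f is nonzero: for f = 0 one has μ_f(p^e) = 1 for all e, so G_f(z) = 1/(1−z) has no pole at z = 1/p and the claim fails. *)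

(* Defs.v *)
From HB Require Import structures.
From mathcomp Require Import all_boot all_order all_algebra.
From mathcomp Require Import all_classical all_reals all_analysis.
Set Implicit Arguments. Unset Strict Implicit. Unset Printing Implicit Defensive.
Import Order.TTheory GRing.Theory Num.Theory numFieldNormedType.Exports.
Local Open Scope ring_scope.
Local Open Scope classical_set_scope.

Section CommAlg.
Variable A : comNzRingType.

Definition is_ideal (I : A -> Prop) : Prop :=
  I 0 /\ (forall x y, I x -> I y -> I (x + y)) /\ (forall a x, I x -> I (a * x)).

Definition is_prime_ideal (P : A -> Prop) : Prop :=
  is_ideal P /\ ~ P 1 /\ (forall a b, P (a * b) -> P a \/ P b).

Definition is_maximal_ideal (M : A -> Prop) : Prop :=
  is_ideal M /\ ~ M 1 /\
  (forall J, is_ideal J -> (forall x, M x -> J x) -> (forall x, J x <-> M x) \/ J 1).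

Definition is_local_ring (m : A -> Prop) : Prop :=
  is_maximal_ideal m /\
  (forall M, is_maximal_ideal M -> forall x, M x <-> m x).

Definition in_span (n : nat) (g : 'I_n -> A) (x : A) : Prop :=
  exists c : 'I_n -> A, x = \sum_(i < n) c i * g i.

Definition finitely_generated (I : A -> Prop) : Prop :=
  exists n (g : 'I_n -> A), forall x, I x <-> in_span g x.

Definition noetherian : Prop :=
  forall I, is_ideal I -> finitely_generated I.

Definition has_prime_chain (n : nat) : Prop :=
  exists P : nat -> A -> Prop,
    (forall i, (i <= n)%N -> is_prime_ideal (P i)) /\
    (forall i, (i < n)%N ->
       (forall x, P i x -> P i.+1 x) /\ exists x, P i.+1 x /\ ~ P i x).

Definition krull_dim_eq (d : nat) : Prop :=
  has_prime_chain d /\ ~ has_prime_chain d.+1.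

Definition is_regular_local_ring (m : A -> Prop) : Prop :=
  noetherian /\ is_local_ring m /\
  exists d, krull_dim_eq d /\
    exists g : 'I_d -> A, forall x, m x <-> in_span g x.

Definition frob_pow (m : A -> Prop) (q : nat) (x : A) : Prop :=
  exists n (c r : 'I_n -> A),
    (forall i, m (r i)) /\ x = \sum_(i < n) c i * r i ^+ q.

Definition is_mu (m : A -> Prop) (f : A) (q k : nat) : Prop :=
  frob_pow m q (f ^+ k) /\ (forall j, frob_pow m q (f ^+ j) -> (k <= j)%N).
End CommAlg.

Definition fpt (RR : realType) (p : nat) (mu : nat -> nat) : RR :=
  lim ((fun e : nat => (mu e)%:R / (p ^ e)%:R : RR) @ \oo).

(* Main.v *)
(** The colon identity (L^[q] : y^q) = (L : y)^[q] (flatness of Frobenius) makes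
    mu_f(p^e) - 1 the truncation of one base-p expansion c_0 c_1 ..., so the
    generating function is rational as soon as the digits are eventually periodic.
    Let J_e = (m^[p^e] : f^(mu_f(p^e) - 1)).  For the m-primary ideal J_e, the
    smallest k with f^k in J_e^[p^n] is one more than the number with digits
    c_e ... c_(e+n-1); so the tails of the expansion are F-thresholds.

    After completing R, the families of m-primary ideals L defined by conditions
    f^k in L^[q] are determined by their intersections, by linear compactness.
    The ascending chain condition on these intersections shows that no sequence of
    tails decreases lexicographically.  A Hartshorne-Speiser-Lyubeznik argument
    shows that no periodic word is a limit of tails from below: writing I_n for
    the intersection attached to the first n periods, the ideals (I_(n+1) : I_n)
    increase to a radical ideal b with b^2 I_N contained in every I_n, and finite
    length at an associated prime of b forces b to be the unit ideal.  These two
    facts imply eventual periodicity by a limit set argument.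

    Flatness itself comes from length(R/L^[q]) = q^d length(R/L), for which one
    needs that the product of the (q-1)-st powers of the regular parameters is not
    in m^[q]; this follows from Krull's principal ideal theorem. *)
Require Import Defs.
From HB Require Import structures.
From mathcomp Require Import all_boot all_order all_algebra.
From mathcomp Require Import all_classical all_reals all_analysis.
From mathcomp Require Import generic_quotient ring_quotient ring zify.
Set Implicit Arguments. Unset Strict Implicit. Unset Printing Implicit Defensive.
Import Order.TTheory GRing.Theory Num.Theory numFieldNormedType.Exports.
Local Open Scope ring_scope.
Local Open Scope classical_set_scope.

(** * Noetherian rings *)

(** When Frobenius is finite, a regular ring has a smallest ideal L with f^k in L^[q], and chain
    conditions apply to such ideals. Here no finiteness of Frobenius is given, so these ideals are
    replaced by families of m-primary ideals, closed under finite intersection because Frobenius is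
    flat. The completion S must be shown Noetherian, since the ascending chain condition and the
    argument at an associated prime take place there. That mu is unchanged follows from the density
    of R in S and from m^n S contracting to m^n. Everything is expressed through ideals of one ring:
    lengths by adjoining elements that m multiplies into the ideal, localization by saturation. A
    period T of the digits gives the denominator (1 - pz)(1 - z^T). The pole at 1/p is genuine
    because fpt(f) > 0: as f is nonzero, Krull's intersection theorem gives some mu_f(p^e) > 1, and
    (mu_f(p^e) - 1)/p^e never decreases. *)

Lemma asc_le (T : Type) (F : nat -> set T) : (forall n, F n `<=` F n.+1) ->
  forall n k, (n <= k)%N -> F n `<=` F k.
Proof.
move=> hS n k; elim: k => [|k IHk]; first by rewrite leqn0 => /eqP ->.
rewrite leq_eqVlt => /orP [/eqP -> //|/IHk h] z /h; exact: hS.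
Qed.

Lemma desc_le (T : Type) (F : nat -> set T) : (forall n, F n.+1 `<=` F n) ->
  forall n k, (n <= k)%N -> F k `<=` F n.
Proof.
move=> hS n k; elim: k => [|k IHk]; first by rewrite leqn0 => /eqP ->.
rewrite leq_eqVlt => /orP [/eqP -> //|/IHk h] z /hS; exact: h.
Qed.

Section Ideals.
Variable A : comNzRingType.
Implicit Types (I J K L P Q : set A) (s : seq A).

Lemma ideal0 I : is_ideal I -> I 0. Proof. by case. Qed.
Lemma idealD I x y : is_ideal I -> I x -> I y -> I (x + y).
Proof. by case=> _ [+ _]; apply. Qed.
Lemma idealMl I a x : is_ideal I -> I x -> I (a * x).
Proof. by case=> _ [_]; apply. Qed.
Lemma idealMr I a x : is_ideal I -> I x -> I (x * a).
Proof. by rewrite mulrC; apply: idealMl. Qed.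
Lemma idealN I x : is_ideal I -> I x -> I (- x).
Proof. by move=> hI Ix; rewrite -mulN1r; apply: idealMl. Qed.
Lemma idealB I x y : is_ideal I -> I x -> I y -> I (x - y).
Proof. by move=> hI Ix Iy; apply: idealD => //; apply: idealN. Qed.
Lemma ideal_full I : is_ideal I -> I 1 -> forall x, I x.
Proof. by move=> hI I1 x; rewrite -(mulr1 x); apply: idealMl. Qed.

Lemma idealT : is_ideal (@setT A). Proof. by []. Qed.

Lemma prime_ideal P : is_prime_ideal P -> is_ideal P. Proof. by case. Qed.
Lemma prime_not1 P : is_prime_ideal P -> ~ P 1. Proof. by case=> _ []. Qed.
Lemma prime_notM P a b : is_prime_ideal P -> ~ P a -> ~ P b -> ~ P (a * b).
Proof. by case=> _ [_ h] Pa Pb /h []. Qed.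
Lemma prime_Mr P a b : is_prime_ideal P -> ~ P a -> P (a * b) -> P b.
Proof. by case=> _ [_ h] Pa /h []. Qed.
Lemma prime_X P a n : is_prime_ideal P -> P (a ^+ n) -> P a.
Proof.
move=> hP; elim: n => [|n IHn]; first by rewrite expr0 => /(prime_not1 hP).
by rewrite exprS => /(hP.2.2 a (a ^+ n)) [].
Qed.

(** For an ideal [I] this is the product of [I] with the ideal generated by [s]. Recursion on the
    list lets generators be peeled off one at a time. *)
Fixpoint lincomb I s (z : A) : Prop :=
  if s is b :: s' then exists r y, [/\ I r, lincomb I s' y & z = r * b + y]
  else z = 0.

Definition idgen s := lincomb setT s.

Lemma lincomb_ideal I s : is_ideal I -> is_ideal (lincomb I s).
Proof.
move=> hI; elim: s => [|b s [h0 [hD hM]]].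
  by split=> //; split=> [x y -> ->|a x ->] /=; rewrite ?addr0 ?mulr0.
split; first by exists 0, 0; split; rewrite ?mul0r ?addr0 //; apply: ideal0.
split=> [x y [r [u [Ir su ->]]] [r' [u' [Ir' su' ->]]]|a x [r [u [Ir su ->]]]].
  exists (r + r'), (u + u'); split; [exact: idealD|exact: hD|ring].
by exists (a * r), (a * u); split; [exact: idealMl|exact: hM|ring].
Qed.

Lemma idgen_ideal s : is_ideal (idgen s).
Proof. exact/lincomb_ideal/idealT. Qed.

Lemma idgen_mem s b : b \in s -> idgen s b.
Proof.
elim: s => // c s IHs; rewrite inE => /orP [/eqP ->|bs].
  by exists 1, 0; split; rewrite ?mul1r ?addr0 //; apply: (ideal0 (idgen_ideal s)).
by exists 0, b; split; rewrite ?mul0r ?add0r //; apply: IHs.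
Qed.

Lemma lincomb_sub I s J : is_ideal J ->
  (forall r b, I r -> b \in s -> J (r * b)) -> lincomb I s `<=` J.
Proof.
move=> hJ; elim: s => [|b s IHs] h z /=; first by move=> ->; apply: ideal0.
case=> r [y [Ir sy ->]]; apply: idealD => //; first by apply: h; rewrite ?inE ?eqxx.
by apply: IHs sy => r' b' Ir' b's; apply: h; rewrite ?inE ?b's ?orbT.
Qed.

Lemma idgen_sub s J : is_ideal J -> (forall b, b \in s -> J b) -> idgen s `<=` J.
Proof. by move=> hJ h; apply: lincomb_sub => // r b _ bs; apply: idealMl => //; apply: h. Qed.

Lemma idgen_subset s s' : {subset s <= s'} -> idgen s `<=` idgen s'.
Proof. by move=> h; apply: idgen_sub => [|b /h]; [exact: idgen_ideal|exact: idgen_mem]. Qed.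

Lemma lincomb_mul I s r z : is_ideal I -> I r -> idgen s z -> lincomb I s (r * z).
Proof.
move=> hI Ir; elim: s z => [|b s IHs] z /=; first by move=> ->; rewrite mulr0.
case=> c [y [_ sy ->]]; exists (r * c), (r * y); split; last by ring.
  exact: idealMr.
exact: IHs.
Qed.

Lemma lincombS I J s : I `<=` J -> lincomb I s `<=` lincomb J s.
Proof.
move=> IJ; elim: s => [|b s IHs] z //= [r [y [Ir sy ->]]].
by exists r, y; split; [exact: IJ|exact: IHs|].
Qed.

Definition addI I J : set A := fun z => exists i j, [/\ I i, J j & z = i + j].

Lemma addI_ideal I J : is_ideal I -> is_ideal J -> is_ideal (addI I J).
Proof.
move=> hI hJ; split; first by exists 0, 0; rewrite addr0; split=> //; apply: ideal0.
split=> [x y [i [j [Ii Jj ->]]] [i' [j' [Ii' Jj' ->]]]|a x [i [j [Ii Jj ->]]]].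
  by exists (i + i'), (j + j'); split; [exact: idealD|exact: idealD|ring].
by exists (a * i), (a * j); split; [exact: idealMl|exact: idealMl|ring].
Qed.

Lemma addI_l I J : is_ideal J -> I `<=` addI I J.
Proof. by move=> hJ z Iz; exists z, 0; rewrite addr0; split=> //; apply: ideal0. Qed.
Lemma addI_r I J : is_ideal I -> J `<=` addI I J.
Proof. by move=> hI z Jz; exists 0, z; rewrite add0r; split=> //; apply: ideal0. Qed.
Lemma addI_sub I J K : is_ideal K -> I `<=` K -> J `<=` K -> addI I J `<=` K.
Proof. by move=> hK IK JK z [i [j [/IK Ki /JK Kj ->]]]; apply: idealD. Qed.

Definition adj I (y : A) := addI I (fun z => exists r, z = r * y).

Lemma mul_ideal (y : A) : is_ideal (fun z => exists r, z = r * y).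
Proof.
split; first by exists 0; rewrite mul0r.
split=> [x z [r ->] [r' ->]|a x [r ->]]; first by exists (r + r'); ring.
by exists (a * r); ring.
Qed.
Lemma adj_ideal I y : is_ideal I -> is_ideal (adj I y).
Proof. by move=> hI; apply: addI_ideal => //; apply: mul_ideal. Qed.
Lemma adj_sub_l I y : I `<=` adj I y.
Proof. exact/addI_l/mul_ideal. Qed.
Lemma adj_mem I y : is_ideal I -> adj I y y.
Proof. by move=> hI; apply: addI_r => //; exists 1; rewrite mul1r. Qed.
Lemma adj_sub I y K : is_ideal K -> I `<=` K -> K y -> adj I y `<=` K.
Proof. by move=> hK IK Ky; apply: addI_sub => // z [r ->]; apply: idealMl. Qed.

Definition colon I (y : A) : set A := fun z => I (z * y).
Lemma colon_ideal I y : is_ideal I -> is_ideal (colon I y).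
Proof.
move=> hI; rewrite /colon; split; first by rewrite mul0r; apply: ideal0.
split=> [a b ha hb|a b hb]; first by rewrite mulrDl; apply: idealD.
by rewrite -mulrA; apply: idealMl.
Qed.
Lemma colon_sub I y : is_ideal I -> I `<=` colon I y.
Proof. by move=> hI z Iz; apply: idealMr. Qed.

Definition colonI I J : set A := fun z => forall y, J y -> I (z * y).
Lemma colonI_ideal I J : is_ideal I -> is_ideal (colonI I J).
Proof.
move=> hI; split; first by move=> y _; rewrite mul0r; apply: ideal0.
split=> [a b ha hb y Jy|a b hb y Jy]; first by rewrite mulrDl; apply: idealD; auto.
by rewrite -mulrA; apply: idealMl => //; apply: hb.
Qed.

Lemma setI_ideal I J : is_ideal I -> is_ideal J -> is_ideal (I `&` J).
Proof.
move=> hI hJ; split; first by split; apply: ideal0.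
split=> [x y [Ix Jx] [Iy Jy]|a x [Ix Jx]]; first by split; apply: idealD.
by split; apply: idealMl.
Qed.

Definition bigI (F : set (set A)) : set A := fun z => forall I, F I -> I z.
Lemma bigI_ideal (F : set (set A)) :
  (forall I, F I -> is_ideal I) -> is_ideal (bigI F).
Proof.
move=> hF; split; first by move=> I /hF; apply: ideal0.
split=> [x y hx hy I FI|a x hx I FI]; have hI := hF _ FI.
  by apply: idealD; [|exact: hx|exact: hy].
by apply: idealMl; [|exact: hx].
Qed.

Definition genI (X : set A) : set A := bigI [set I | is_ideal I /\ X `<=` I].
Lemma genI_ideal X : is_ideal (genI X).
Proof. by apply: bigI_ideal => I []. Qed.
Lemma genI_mem (X : set A) : X `<=` genI X.
Proof. by move=> z Xz I [_]; apply. Qed.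
Lemma genI_sub (X : set A) I : is_ideal I -> X `<=` I -> genI X `<=` I.
Proof. by move=> hI XI z; apply; split. Qed.

Definition mulI I J := genI (fun z => exists i j, [/\ I i, J j & z = i * j]).

Lemma mulI_mem I J i j : I i -> J j -> mulI I J (i * j).
Proof. by move=> Ii Jj; apply: genI_mem; exists i, j. Qed.
Lemma mulI_sub I J K : is_ideal K -> (forall i j, I i -> J j -> K (i * j)) ->
  mulI I J `<=` K.
Proof. by move=> hK h; apply: genI_sub => // z [i [j [Ii Jj ->]]]; apply: h. Qed.

Definition fg I := exists s, forall z, I z <-> idgen s z.
Definition noeth := forall I, is_ideal I -> fg I.

Lemma noetherian_noeth : noetherian A -> noeth.
Proof.
move=> hN I /hN [n [g hg]]; exists [seq g i | i <- enum 'I_n] => z; split.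
  move=> /hg [c ->]; elim/big_ind: _ => [|x y|i _].
  - exact: (ideal0 (idgen_ideal _)).
  - by move=> ? ?; apply: idealD => //; apply: idgen_ideal.
  - apply: idealMl; first exact: idgen_ideal.
    by apply/idgen_mem/map_f; rewrite mem_enum.
have hI : is_ideal I.
  split; first by apply/hg; exists (fun=> 0); rewrite big1 // => i _; rewrite mul0r.
  split=> [x y /hg [c ->] /hg [c' ->]|a x /hg [c ->]]; apply/hg.
    by exists (fun i => c i + c' i); rewrite -big_split; apply: eq_bigr => i _; rewrite mulrDl.
  by exists (fun i => a * c i); rewrite mulr_sumr; apply: eq_bigr => i _; rewrite mulrA.
apply: idgen_sub => // _ /mapP [i _ ->]; apply/hg; exists (fun j => (j == i)%:R).
rewrite (bigD1 i) //= eqxx mul1r big1 ?addr0 // => j /negPf ->.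
by rewrite mul0r.
Qed.

Lemma asc_ideal (F : nat -> set A) : (forall n, is_ideal (F n)) ->
  (forall n, F n `<=` F n.+1) -> is_ideal (fun z => exists n, F n z).
Proof.
move=> hF hS; have hle := asc_le hS.
split; first by exists 0; apply: ideal0.
split=> [x y [n hx] [k hy]|a x [n hx]]; last by exists n; apply: idealMl.
exists (maxn n k); apply: idealD => //.
  by apply: (hle n) => //; rewrite leq_maxl.
by apply: (hle k) => //; rewrite leq_maxr.
Qed.

(** Only the union is assumed finitely generated: the lemma also serves in the completion before
    that ring is known to be Noetherian. *)
Lemma asc_stable (F : nat -> set A) : (forall n, is_ideal (F n)) ->
  (forall n, F n `<=` F n.+1) -> fg (fun z => exists n, F n z) ->
  exists N, forall n, (N <= n)%N -> F n `<=` F N.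
Proof.
move=> hF hS [s hs]; have hle := asc_le hS.
have [N hNs] : exists N, forall b, b \in s -> F N b.
  have : forall b, b \in s -> exists n, F n b by move=> b bs; apply/hs/idgen_mem.
  elim: {hs} s => [|b s IHs] h; first by exists 0.
  have [|N hNs] := IHs; first by move=> c cs; apply: h; rewrite inE cs orbT.
  have [n hn] := h b (mem_head _ _).
  exists (maxn N n) => c; rewrite inE => /orP [/eqP ->|/hNs].
    by apply: (hle n) => //; rewrite leq_maxr.
  by apply: hle; rewrite leq_maxl.
exists N => n _ z Fz; have /hs : exists n, F n z by exists n.
exact: idgen_sub.
Qed.

Hypothesis hN : noeth.

Lemma acc (F : nat -> set A) : (forall n, is_ideal (F n)) ->
  (forall n, F n `<=` F n.+1) ->
  exists N, forall n, (N <= n)%N -> F n `<=` F N.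
Proof. by move=> hF hS; apply: asc_stable => //; apply/hN/asc_ideal. Qed.

Lemma max_ideal (C : set (set A)) I0 : C I0 -> (forall I, C I -> is_ideal I) ->
  exists2 M, C M & I0 `<=` M /\ forall J, C J -> M `<=` J -> J `<=` M.
Proof.
move=> C0 hC; apply: contrapT => hno.
pose T := {M : set A | C M /\ I0 `<=` M}.
have step (M : T) : exists J : T, sval M `<=` sval J /\ ~ sval J `<=` sval M.
  apply: contrapT => h; apply: hno; exists (sval M); first exact: (svalP M).1.
  split=> [|J CJ MJ]; first exact: (svalP M).2.
  apply: contrapT => hJM; apply: h.
  by exists (exist _ J (conj CJ (subset_trans (svalP M).2 MJ))).
have [g hg] := choice step.
pose u n := iter n g (exist _ I0 (conj C0 (fun z => id))).
have [N hNn] : exists N, forall n, (N <= n)%N -> sval (u n) `<=` sval (u N).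
  by apply: acc => n; [apply: hC; apply: (svalP (u n)).1|exact: (hg (u n)).1].
exact: (hg (u N)).2 (hNn N.+1 (leqnSn N)).
Qed.

(** * Primes and localization: Nakayama's lemma, chains of finite length *)

Lemma prime_avoid (X : set A) I : is_ideal I -> X 1 ->
  (forall x y, X x -> X y -> X (x * y)) -> (forall z, I z -> ~ X z) ->
  exists P, [/\ is_prime_ideal P, I `<=` P & forall z, P z -> ~ X z].
Proof.
move=> hI X1 XM hIX.
have [||P [hP PX] [IP Pmax]] :=
  @max_ideal [set J | is_ideal J /\ forall z, J z -> ~ X z] I; [by []|by move=> J []|].
exists P; split=> //; split=> //; split=> [/PX|a b Pab]; first by [].
apply: contrapT => /not_orP [Pa Pb].
have meet c : ~ P c -> exists2 z, adj P c z & X z.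
  move=> Pc; apply: contrapT => hno; apply: Pc.
  apply: (Pmax (adj P c)); [|exact: adj_sub_l|exact: adj_mem].
  by split=> [|z Pz Xz]; [exact: adj_ideal|apply: hno; exists z].
have [x [i [_ [Pi [r ->] ->]]] Xx] := meet _ Pa.
have [y [j [_ [Pj [r' ->] ->]]] Xy] := meet _ Pb.
apply: (PX _ _ (XM _ _ Xx Xy)).
have -> : (i + r * a) * (j + r' * b) = (j + r' * b) * i + (r * a * j + r * r' * (a * b)) by
  ring.
by do ![apply: idealD => //|apply: idealMl => //].
Qed.

(** The contraction to [A] of the extension of [I] to the localization at [P]. *)
Definition satur P I : set A := fun z => exists2 t, ~ P t & I (t * z).

Lemma satur_ideal P I : is_prime_ideal P -> is_ideal I -> is_ideal (satur P I).
Proof.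
move=> hP hI; split; first by exists 1; [exact: prime_not1|rewrite mulr0; exact: ideal0].
split=> [x y [t Pt Ix] [t' Pt' Iy]|a x [t Pt Ix]]; last first.
  by exists t => //; rewrite mulrCA; apply: idealMl.
exists (t * t'); first exact: prime_notM.
have -> : t * t' * (x + y) = t' * (t * x) + t * (t' * y) by ring.
by apply: idealD => //; apply: idealMl.
Qed.

Lemma satur_sub P I : is_prime_ideal P -> I `<=` satur P I.
Proof. by move=> hP z Iz; exists 1; [exact: prime_not1|rewrite mul1r]. Qed.

Lemma saturS P I J : I `<=` J -> satur P I `<=` satur P J.
Proof. by move=> IJ z [t Pt /IJ Jz]; exists t. Qed.

Lemma satur_satur P I : is_prime_ideal P -> is_ideal I ->
  satur P (satur P I) `<=` satur P I.
Proof.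
move=> hP hI z [t Pt [t' Pt' Iz]]; exists (t' * t); first exact: prime_notM.
by rewrite -mulrA.
Qed.

(* Instead of a determinant, the generators are eliminated one at a time:
   t * b = j + (a * b + y) with a in P gives (t - a) * b = j + y and t - a is
   still outside P. *)
Lemma nakayama_idgen P J s : is_prime_ideal P -> is_ideal J ->
  (forall b, b \in s -> satur P (addI J (lincomb P s)) b) -> idgen s `<=` satur P J.
Proof.
move=> hP hJ; have hP' := prime_ideal hP.
elim: s => [|b s IHs] h z; first by move=> ->; apply: (ideal0 (satur_ideal _ _)).
have [t Pt [j [_ [Jj [a [y [Pa sy ->]]] etb]]]] := h b (mem_head _ _).
pose t' := t - a.
have Pt' : ~ P t'.
  by move=> Pt'; apply: Pt; rewrite -(subrK a t); apply: idealD.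
have etb' : t' * b = j + y by rewrite mulrBl etb; ring.
have hs : idgen s `<=` satur P J.
  apply: IHs => c cs.
  have [|u Pu [k [_ [Jk [r [x [Pr sx ->]]] euc]]]] := h c; first by rewrite inE cs orbT.
  exists (t' * u); first exact: prime_notM.
  exists (t' * k + r * j), (t' * x + r * y); split.
  - by apply: idealD => //; apply: idealMl.
  - by apply: idealD; [exact: lincomb_ideal|apply: idealMl => //; apply: lincomb_ideal|
      apply: idealMl => //; apply: lincomb_ideal].
  - by rewrite -mulrA euc -[r * b + x]addrC !mulrDr [t' * (r * b)]mulrCA etb'; ring.
have hb : satur P J b.
  have hy : satur P J y by apply/hs; apply: lincombS sy.
  apply: satur_satur => //; exists t' => //; rewrite etb'.
  by apply: idealD => //; [exact: satur_ideal|exact: satur_sub].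
move=> [r [w [_ sw ->]]]; apply: idealD; first exact: satur_ideal.
  by apply: idealMl => //; apply: satur_ideal.
exact: hs.
Qed.

Lemma nakayama P I J : is_prime_ideal P -> is_ideal I -> is_ideal J ->
  (forall z, I z -> satur P (addI J (mulI P I)) z) -> I `<=` satur P J.
Proof.
move=> hP hI hJ h; have [s hs] := hN hI.
move=> z /hs; apply: nakayama_idgen => // b bs.
have [t Pt hb] := h b (proj2 (hs b) (idgen_mem bs)); exists t => //.
move: hb => [j [y [Jj hy ->]]]; exists j, y; split=> //.
move: y hy; apply: mulI_sub; first exact/lincomb_ideal/prime_ideal.
by move=> i k Pi /hs; apply: lincomb_mul => //; apply: prime_ideal.
Qed.

(** A single denominator [t] serves all of [F n], so that [t] lies in the colon ideal of [F n.+1] by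
    [F n]; stability is exploited in this form. *)
Definition locally_stable P (F : nat -> set A) :=
  exists n0, forall n, (n0 <= n)%N ->
  exists2 t, ~ P t & forall z, F n z -> F n.+1 (t * z).

(* Rank induction over the residue field at P: the coefficients of the first
   generator either all lie in P from some point on, or one escapes P. *)
Lemma stable_layer P K s (F : nat -> set A) : is_prime_ideal P -> is_ideal K ->
  (forall n, is_ideal (F n)) -> (forall n, F n.+1 `<=` F n) ->
  (forall n, K `<=` F n) -> (forall n, F n `<=` addI (idgen s) K) ->
  (forall r b, P r -> b \in s -> K (r * b)) -> locally_stable P F.
Proof.
move=> hP hK; elim: s F => [|b s IHs] F hF hS hKF hFs hPs.
  exists 0 => n _; exists 1; first exact: prime_not1.
  move=> z /hFs [_ [k [-> Kk ->]]]; apply: hKF; rewrite mul1r add0r //.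
have hle := desc_le hS.
pose G n := F n `&` addI (idgen s) K.
have hsK : is_ideal (addI (idgen s) K) by apply: addI_ideal => //; apply: idgen_ideal.
have [|||||n0 hn0] := IHs G.
- by move=> n; apply: setI_ideal.
- by move=> n z [/hS].
- by move=> n z Kz; split; [exact: hKF|apply: addI_r => //; apply: idgen_ideal].
- by move=> n z [].
- by move=> r c Pr cs; apply: hPs; rewrite ?inE ?cs ?orbT.
have split_mem n z : F n z -> exists c y, addI (idgen s) K y /\ z = c * b + y.
  move=> /hFs [_ [k [[c [y [_ sy ->]]] Kk ->]]].
  by exists c, (y + k); split; [exists y, k|ring].
have [hA|] := pselect (forall n, exists r y, [/\ ~ P r, addI (idgen s) K y & F n (r * b + y)]).
  exists n0 => n len; have [t Pt ht] := hn0 n len.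
  have [r [y [Pr sy Fy]]] := hA n.+1.
  exists (t * r); first exact: prime_notM.
  move=> z Fz; have [c [y' [sy' ez]]] := split_mem _ _ Fz.
  have : F n.+1 (t * (r * z - c * (r * b + y))).
    apply: (ht _ _).1; split.
      by apply: idealB => //; [exact: idealMl|apply: idealMl => //; exact: hS].
    have -> : r * z - c * (r * b + y) = r * y' - c * y by rewrite ez; ring.
    by apply: idealB => //; apply: idealMl.
  move=> h; have -> : t * r * z = t * (r * z - c * (r * b + y)) + t * c * (r * b + y) by ring.
  by apply: idealD => //; apply: idealMl.
move=> /existsNP [n1 hn1]; exists (maxn n0 n1) => n.
rewrite geq_max => /andP [len0 len1]; have [t Pt ht] := hn0 n len0.
exists t => // z Fz; have [c [y' [sy' ez]]] := split_mem _ _ Fz.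
have Pc : P c.
  apply: contrapT => Pc; apply: hn1; exists c, y'; split=> //.
  by rewrite -ez; apply: hle Fz.
have Kcb : K (c * b) by apply: hPs; rewrite ?mem_head.
have -> : t * z = t * (c * b) + t * y' by rewrite ez mulrDr.
apply: idealD => //; first by apply: idealMl => //; apply: hKF.
apply: (ht _ _).1; split=> //.
have -> : y' = z - c * b by rewrite ez; ring.
by apply: idealB => //; apply: hKF.
Qed.

(** At [P] the element [t0] is a unit, so the chain lives in I / P^N I, of finite length. Induction
    on [N]: the traces on P I are stable by induction, the images in I / P I by [stable_layer]. *)
Lemma stable_at_prime P N t0 I (F : nat -> set A) : is_prime_ideal P -> ~ P t0 ->
  is_ideal I -> (forall n, is_ideal (F n)) -> (forall n, F n.+1 `<=` F n) ->
  (forall n, F n `<=` I) ->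
  (forall n us z, size us = N -> (forall u, u \in us -> P u) -> I z ->
     F n (t0 * (\prod_(u <- us) u * z))) ->
  locally_stable P F.
Proof.
move=> hP Pt0; have hP' := prime_ideal hP.
elim: N I F => [|N IHN] I F hI hF hS hFI hpow.
  exists 0 => n _; exists t0 => // z /hFI Iz.
  by have := hpow n.+1 [::] z erefl; rewrite big_nil mul1r; apply.
pose PI := mulI P I; have hPI : is_ideal PI by exact: genI_ideal.
have PII : PI `<=` I by apply: mulI_sub => // i j _; apply: idealMl.
have [||||n0 hn0] := IHN PI (fun n => F n `&` PI) hPI.
- by move=> n; apply: setI_ideal.
- by move=> n z [/hS].
- by move=> n z [].
- move=> n us z sus hus PIz; split; last exact: idealMl hPI (idealMl _ hPI PIz).
  suff: PI `<=` (fun z => F n (t0 * (\prod_(u <- us) u * z))) by apply.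
  apply: mulI_sub.
    split; first by rewrite !mulr0; apply: ideal0.
    split=> [x y hx hy|a x hx]; first by rewrite !mulrDr; apply: idealD.
    by rewrite (mulrCA _ a) (mulrCA _ a); apply: idealMl.
  move=> i j Pi Ij; have := hpow n (i :: us) j; rewrite big_cons /= sus.
  rewrite (_ : i * _ * j = \prod_(u <- us) u * (i * j)); last by ring.
  by apply=> // u; rewrite inE => /orP [/eqP ->|/hus].
have [s hs] := hN hI.
have [|||||n1 hn1] := @stable_layer P PI s (fun n => addI (F n) PI) hP hPI.
- by move=> n; apply: addI_ideal.
- by move=> n; apply: addI_sub => [|z /hS /(addI_l hPI) //|]; [exact: addI_ideal|exact: addI_r].
- by move=> n; apply: addI_r.
- move=> n; apply: addI_sub; [|move=> z /hFI /hs|]; [|exact: addI_l|].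
    by apply: addI_ideal => //; apply: idgen_ideal.
  by apply: addI_r; apply: idgen_ideal.
- by move=> r b Pr bs; apply: mulI_mem => //; apply/hs/idgen_mem.
exists (maxn n0 n1) => n; rewrite geq_max => /andP [/hn0 [t Pt ht] /hn1 [t' Pt' ht']].
exists (t * t'); first exact: prime_notM.
move=> z Fz; have [y [u [Fy PIu e]]] := ht' z (addI_l hPI Fz).
rewrite -mulrA e mulrDr; apply: idealD => //; first exact: idealMl.
apply: (ht _ _).1; split=> //.
have -> : u = t' * z - y by rewrite e; ring.
by apply: idealB => //; [exact: idealMl|exact: hS].
Qed.

(** By induction modulo [b], products of N factors fall in J + (b); hence products of k N factors
    fall in J + (b^k), which is J once b^k is in J. *)
Lemma prod_in_ideal s J : is_ideal J -> (forall b, b \in s -> exists k, J (b ^+ k)) ->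
  exists N, forall us, (N <= size us)%N -> (forall u, u \in us -> idgen s u) ->
    J (\prod_(u <- us) u).
Proof.
elim: s J => [|b s IHs] J hJ h.
  exists 1%N => -[|u us] // _ /(_ u (mem_head _ _)) ->.
  by rewrite big_cons mul0r; apply: ideal0.
have [N0 hN0] : exists N, forall us, (N <= size us)%N ->
    (forall u, u \in us -> idgen (b :: s) u) -> adj J b (\prod_(u <- us) u).
  have [|c cs|N hNs] := IHs (adj J b); first exact: adj_ideal.
    have [|k Jk] := h c; first by rewrite inE cs orbT.
    by exists k; apply: adj_sub_l.
  exists N => us hsz hus.
  have [vs [sz hvs hd]] : exists vs, [/\ size vs = size us,
      forall v, v \in vs -> idgen s v &
      adj J b (\prod_(u <- us) u - \prod_(v <- vs) v)].
    elim: us {hsz} hus => [|u us IHus] hus.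
      by exists [::]; split=> //; rewrite subrr; apply: (ideal0 (adj_ideal _ hJ)).
    have [|vs [sz hvs hd]] := IHus; first by move=> v vus; apply: hus; rewrite inE vus orbT.
    have [r [y [_ sy eu]]] := hus u (mem_head _ _).
    exists (y :: vs); split=> [|v|]; first by rewrite /= sz.
      by rewrite inE => /orP [/eqP ->|/hvs].
    rewrite !big_cons; set p1 := \prod_(_ <- us) _; set p2 := \prod_(_ <- vs) _.
    have -> : u * p1 - y * p2 = (p1 * r) * b + y * (p1 - p2) by rewrite eu; ring.
    by apply: idealD; rewrite ?/p1 ?/p2; [exact: adj_ideal| |];
       apply: idealMl => //; (exact: adj_ideal || exact: adj_mem).
  have := hNs vs; rewrite sz => /(_ hsz hvs) hv.
  by rewrite -(subrK (\prod_(v <- vs) v) (\prod_(u <- us) u)); apply: idealD => //;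
    exact: adj_ideal.
have [k hk] := h b (mem_head _ _).
exists (k * N0)%N => us hsz hus.
suff h' : forall k us, (k * N0 <= size us)%N -> (forall u, u \in us -> idgen (b :: s) u) ->
    adj J (b ^+ k) (\prod_(u <- us) u).
  have := h' k us hsz hus; apply: adj_sub => //.
move=> {us hsz hus hk}{}k; elim: k => [|k IHk] us hsz hus.
  have := adj_mem 1 hJ; rewrite expr0 => /(ideal_full (adj_ideal 1 hJ)) //.
rewrite -(cat_take_drop N0 us) big_cat /=.
have le0 : (N0 <= size us)%N by apply: leq_trans hsz; rewrite mulSn leq_addr.
have [||i [_ [Ji [r ->] ->]]] := hN0 (take N0 us).
- by rewrite size_takel.
- by move=> u /mem_take; apply: hus.
have [||j [_ [Jj [r' ->] ->]]] := IHk (drop N0 us).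
- by rewrite size_drop leq_subRL // -mulSn.
- by move=> u /mem_drop; apply: hus.
exists (i * j + i * (r' * b ^+ k) + r * b * j), (r * r' * b ^+ k.+1); split.
- by apply: idealD => //; [apply: idealD => //|];
  [exact: idealMl|exact: idealMr|exact: idealMl].
- by exists (r * r').
- by rewrite exprS; ring.
Qed.

End Ideals.

(** * Principal ideal theorem and regular parameters *)

Section RegularSequences.
Variable A : comNzRingType.
Implicit Types (I J K L P Q m : set A) (s l r xs : seq A).
Hypothesis hN : noeth A.

(* Under the minimality hypothesis on P, the ring is Artinian at P modulo Q0 + (x). *)
Lemma symbolic_power_stable Q0 Q P x :
  is_prime_ideal Q0 -> is_prime_ideal Q -> is_prime_ideal P ->
  Q0 `<=` Q -> Q `<=` P -> P x -> ~ Q x ->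
  (forall P', is_prime_ideal P' -> Q0 `<=` P' -> P' x -> P' `<=` P -> P `<=` P') ->
  forall W : nat -> set A, (forall n, is_ideal (W n)) -> (forall n, W n.+1 `<=` W n) ->
  (forall n, Q0 `<=` W n) ->
  exists n, W n `<=` satur Q (W n.+1).
Proof.
move=> hQ0 hQ hP Q0Q QP Px Qx hmin W hW hWS Q0W.
have [iQ0 iQ iP] := And3 (prime_ideal hQ0) (prime_ideal hQ) (prime_ideal hP).
pose K := satur P (adj Q0 x).
have hK : is_ideal K by apply: satur_ideal => //; apply: adj_ideal.
have rad u : P u -> exists k, K (u ^+ k).
  move=> Pu; apply: contrapT => hno.
  pose X := fun z => exists t k, ~ P t /\ z = t * u ^+ k.
  have [||||P' [hP' QP' P'X]] := @prime_avoid _ hN X (adj Q0 x).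
  - exact: adj_ideal.
  - by exists 1, 0; rewrite expr0 mulr1; split=> //; apply: prime_not1.
  - move=> _ _ [t [k [Pt ->]]] [t' [k' [Pt' ->]]]; exists (t * t'), (k + k').
    by split; [exact: prime_notM|rewrite exprD; ring].
  - by move=> z Qz [t [k [Pt ez]]]; apply: hno; exists k, t; rewrite // -ez.
  have P'P : P' `<=` P.
    move=> z P'z; apply: contrapT => Pz; apply: (P'X z) => //.
    by exists z, 0; rewrite expr0 mulr1.
  apply: (P'X u); last by exists 1, 1; rewrite expr1 mul1r; split=> //; apply: prime_not1.
  apply: (hmin P') => //; first by move=> z Q0z; apply/QP'/adj_sub_l.
  exact/QP'/adj_mem.
have [s hs] := hN iP.
have [N hNs] := @prod_in_ideal _ s K hK (fun b bs => rad b (proj2 (hs b) (idgen_mem bs))).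
pose F n := satur P (adj (satur Q (W n)) x).
have hsW n : is_ideal (satur Q (W n)) by exact: satur_ideal.
have haW n : is_ideal (adj (satur Q (W n)) x) by exact: adj_ideal.
have hF n : is_ideal (F n) by apply: satur_ideal.
have [|||n0 /(_ n0 (leqnn _)) [t Pt ht]] :=
  @stable_at_prime _ hN P N 1 setT F hP (prime_not1 hP) (@idealT A) hF.
- move=> n; apply: saturS; apply: adj_sub => //; last exact: adj_mem.
  by move=> z Wz; apply: adj_sub_l; apply: saturS Wz.
- by [].
- move=> n us z sus hus _; rewrite mul1r; apply: idealMr => //.
  have : K (\prod_(u <- us) u) by apply: hNs; [rewrite sus|move=> u /hus /hs].
  apply: saturS; apply: adj_sub => //; last exact: adj_mem.
  by move=> w Q0w; apply/adj_sub_l/satur_sub => //; apply: Q0W.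
exists n0; set V := satur Q (W n0); set V' := satur Q (W n0.+1).
have iV : is_ideal V := hsW n0; have iV' : is_ideal V' := hsW n0.+1.
have V'V : V' `<=` V by apply: saturS.
(* [x] is outside [Q], so it cancels in the [Q]-saturated ideal [V]: an element r x of V has r in V.
   Thus V lies in V' + x V at [P], and Nakayama applies. *)
have hV : V `<=` satur P V'.
  apply: nakayama => //.
  move=> z Vz.
  have [|u Pu [b [c [V'b [r ->] e]]]] := ht z; first by apply: satur_sub => //;
    apply: adj_sub_l.
  exists (u * t); first by apply: prime_notM.
  exists b, (r * x); split=> //; last by rewrite -mulrA.
  have Vr : V r.
    have : V (x * r).
      have -> : x * r = u * (t * z) - b by rewrite e; ring.
      by apply: idealB => //; [do 2!apply: idealMl => //|apply: V'V].
    case=> v Qv Wv; exists (v * x); first exact: prime_notM.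
    by rewrite -mulrA.
  by rewrite mulrC; apply: mulI_mem.
move=> z Wz; have [v Pv V'v] := hV z (satur_sub hQ Wz).
by apply: satur_satur => //; exists v => // /QP.
Qed.

(* Krull's principal ideal theorem: between Q0 and P there is room for a prime
   through x, since otherwise the symbolic powers of Q modulo Q0 would stabilize. *)
Lemma principal_ideal_thm Q0 Q P x :
  is_prime_ideal Q0 -> is_prime_ideal Q -> is_prime_ideal P ->
  Q0 `<=` Q -> Q `<=` P -> ~ Q `<=` Q0 -> ~ P `<=` Q -> P x ->
  exists P', [/\ is_prime_ideal P', Q0 `<=` P', P' x, P' `<=` P & ~ P `<=` P'].
Proof.
move=> hQ0 hQ hP Q0Q QP nQ nP Px.
have [Qx|Qx] := pselect (Q x); first by exists Q.
apply: contrapT => hno.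
have iQ0 := prime_ideal hQ0; have iQ := prime_ideal hQ.
(* [W n] is Q0 + Q^n; saturated at [Q], these are the symbolic powers modulo Q0. Once they
   stabilize, Nakayama at [Q] puts [W n] inside the saturation of Q0, that is inside Q0. *)
pose W := fix W n := if n is n'.+1 then addI Q0 (mulI Q (W n')) else setT.
have hW n : is_ideal (W n) by case: n => [|n] //=; apply: addI_ideal => //; apply: genI_ideal.
have Q0W n : Q0 `<=` W n by case: n => [|n] //=; apply/addI_l/genI_ideal.
have hWS n : W n.+1 `<=` W n.
  elim: n => [|n IHn]; first by move=> z _.
  apply: addI_sub; [exact: (hW n.+1)|exact: (Q0W n.+1)|].
  apply: subset_trans (addI_r iQ0); apply: mulI_sub; first exact: genI_ideal.
  by move=> i j Qi Wj; apply: mulI_mem => //; apply: IHn.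
have [|n hn] := symbolic_power_stable hQ0 hQ hP Q0Q QP Px Qx _ hW hWS Q0W.
  move=> P' hP' Q0P' P'x P'P; apply: contrapT => nPP'; apply: hno.
  by exists P'.
apply: nQ => u Qu.
have Wn : W n (u ^+ n).
  elim: {hn} n => [|n IHn] //; rewrite exprS; apply: addI_r => //.
  exact: mulI_mem.
have [t Qt Q0t] : satur Q Q0 (u ^+ n) by apply: (nakayama hN hQ (hW n) iQ0) Wn.
by apply: (prime_X hQ0 (n := n)); apply: prime_Mr Q0t => // /Q0Q.
Qed.

Definition pchain n (P : nat -> set A) :=
  (forall i, (i <= n)%N -> is_prime_ideal (P i)) /\
  (forall i, (i < n)%N -> P i `<=` P i.+1 /\ ~ P i.+1 `<=` P i).

(** The principal ideal theorem, applied to three consecutive members from the top down, exchanges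
    the middle prime for one through [x] and leaves the ends in place. *)
Lemma pchain_through n (P : nat -> set A) x : pchain n.+1 P -> P n.+1 x ->
  exists P' : nat -> set A, [/\ pchain n.+1 P', P' 0%N = P 0%N, P' n.+1 = P n.+1 & P' 1%N x].
Proof.
move=> hP Px.
suff h j : (j <= n)%N ->
    exists P' : nat -> set A, [/\ pchain n.+1 P', P' 0%N = P 0%N, P' n.+1 = P n.+1 & P' (n.+1
      - j)%N x].
  by have := h n (leqnn n); rewrite subSnn.
elim: j => [|j IHj] lejn; first by exists P; rewrite subn0.
have [P1 [[hpr hst] e0 en P1x]] := IHj (ltnW lejn).
pose k := (n - j.+1)%N.
have ek : (n.+1 - j = k.+2)%N by rewrite /k; lia.
have -> : (n.+1 - j.+1 = k.+1)%N by rewrite /k; lia.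
rewrite ek in P1x; have lek : (k.+2 <= n.+1)%N by rewrite /k; lia.
have [|||||||P2 [hP2 sub0 P2x sub1 nsub]] :=
  @principal_ideal_thm (P1 k) (P1 k.+1) (P1 k.+2) x _ _ _ _ _ _ _ P1x.
- by apply: hpr; lia.
- by apply: hpr; lia.
- by apply: hpr; lia.
- by apply: (hst k _).1; lia.
- by apply: (hst k.+1 _).1; lia.
- by apply: (hst k _).2; lia.
- by apply: (hst k.+1 _).2; lia.
have [P1k1x|nP1x] := pselect (P1 k.+1 x); first by exists P1.
have [P1kx|nP1kx] := pselect (P1 k x).
  by exists P1; split=> //; apply: (hst k _).1 => //; lia.
exists (fun i => if i == k.+1 then P2 else P1 i); split=> //.
- split=> i lei; first by case: eqP => // _; apply: hpr.
  case: eqP => [ei|nei]; case: eqP => [ei'|nei'].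
  + by lia.
  + by rewrite ei.
  + have -> : i = k by lia.
    by split=> // /(_ x P2x).
  + exact: hst.
- by case: eqP => // e; move: e lek; lia.
- by rewrite eqxx.
Qed.

Section Local.
Variables (m : set A) (xs : seq A).
Hypothesis hloc : forall a, ~ m a -> exists b, b * a = 1.
Hypothesis hm : is_prime_ideal m.

Lemma satur_local I : is_ideal I -> satur m I `<=` I.
Proof.
move=> hI z [t /hloc [b bt] It].
by rewrite -(mul1r z) -bt -mulrA; apply: idealMl.
Qed.

(** The chain is as long as [s], so there is no slack. Once it passes through the first generator x,
    induction places its next member inside (pre, x). An element u + c x of P 0 has c in P 0, as x
    is not there; so P 0 = (pre) + x P 0 and Nakayama concludes. *)
Lemma prefix_prime pre s (P : nat -> set A) : (forall z, m z <-> idgen (pre ++ s) z) ->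
  pchain (size s) P -> P (size s) = m -> idgen pre `<=` P 0%N ->
  P 0%N `<=` idgen pre /\
  forall l y r, s = l ++ y :: r -> is_prime_ideal (idgen (pre ++ l)) /\ ~ idgen (pre ++ l) y.
Proof.
elim: s pre P => [|x s IHs] pre P em hP eP hpre.
  split; last by move=> [|? ?].
  by rewrite /= in eP; rewrite eP => z /em; rewrite cats0.
have mx : m x by apply/em/idgen_mem; rewrite mem_cat inE eqxx orbT.
have [|P1 [[hpr hst] e0 en P1x]] := @pchain_through _ _ x hP; first by rewrite eP.
rewrite -e0 in hpre *.
have iP0 : is_prime_ideal (P1 0%N) by apply: hpr.
have [||||sub hI] := IHs (rcons pre x) (fun i => P1 i.+1).
- by move=> z; rewrite em cat_rcons.
- by split=> i lei; [apply: hpr|apply: hst].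
- by rewrite en eP.
- have [s01 _] := hst 0 (ltn0Sn _).
  apply: idgen_sub; first exact/prime_ideal/hpr.
  by move=> b; rewrite mem_rcons inE => /orP [/eqP ->|/idgen_mem /hpre /s01].
have [s01 ns01] := hst 0 (ltn0Sn _).
have nP0x : ~ P1 0%N x.
  move=> P0x; apply: ns01 => z /sub; apply: idgen_sub => [|b].
    exact: prime_ideal.
  by rewrite mem_rcons inE => /orP [/eqP ->|/idgen_mem /hpre].
have sub0 : P1 0%N `<=` idgen pre.
  apply: subset_trans (satur_local (idgen_ideal _)).
  apply: nakayama => //; [exact: prime_ideal|exact: idgen_ideal|].
  move=> z P0z; apply: satur_sub => //.
  have : adj (idgen pre) x z.
    have : idgen (rcons pre x) z by apply/sub/s01.
    apply: idgen_sub => [|b]; first exact/adj_ideal/idgen_ideal.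
    rewrite mem_rcons inE => /orP [/eqP ->|/idgen_mem ?]; first exact/adj_mem/idgen_ideal.
    exact: adj_sub_l.
  case=> u [_ [su [c ->] ez]]; exists u, (c * x); split=> //.
  rewrite mulrC; apply: mulI_mem => //.
  apply: (prime_Mr iP0 nP0x); have -> : x * c = z - u by rewrite ez; ring.
  by apply: idealB => //; [exact: prime_ideal|exact: hpre].
have e : P1 0%N = idgen pre by apply/seteqP; split.
split=> // -[|y l] z r /= [<-] es; first by rewrite cats0 -e.
by have := hI l z r es; rewrite cat_rcons.
Qed.

Hypothesis hxs : forall z, m z <-> idgen xs z.
Variable P : nat -> set A.
Hypotheses (hP : pchain (size xs) P) (hPm : P (size xs) = m).
Hypothesis hP0 : P 0%N 0.

Lemma subseq_prime l y r : perm_eq (l ++ y :: r) xs ->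
  is_prime_ideal (idgen l) /\ ~ idgen l y.
Proof.
move=> hp; have [||||_ /(_ l y r erefl)] := @prefix_prime [::] (l ++ y :: r) P.
- move=> z; rewrite hxs /=; split; apply: idgen_subset => b; by rewrite (perm_mem hp).
- by rewrite (perm_size hp).
- by rewrite (perm_size hp).
- by move=> z ->.
- by [].
Qed.

Definition powers (ps : seq (A * nat)) := [seq u.1 ^+ u.2 | u <- ps].

(* Powers are lowered one at a time; keeping all permutations of the parameters in
   the statement is what makes the induction close. *)
Lemma regular_powers ps y r : perm_eq (map fst ps ++ y :: r) xs ->
  (forall u, u \in ps -> (0 < u.2)%N) ->
  forall z, idgen (powers ps) (z * y) -> idgen (powers ps) z.
Proof.
have [n] := ubnP (sumn (map snd ps)); elim: n ps y r => // n IHn ps y r.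
rewrite ltnS => len hp hpos z.
have [/hasP [[w b] wps /= b1]|/hasPn h1] := boolP (has (fun u : A * nat => (1 < u.2)%N) ps);
  last first.
  have -> : powers ps = map fst ps.
    apply/eq_in_map => u ups; have := h1 u ups; have := hpos u ups.
    by case: u.2 => [|[|k]] //; rewrite expr1.
  have [hpr ny] := subseq_prime hp.
  by rewrite mulrC; apply: prime_Mr.
case: b b1 wps => [|[|b]] // _ wps.
have [ps' hps'] : exists ps', perm_eq ps ((w, b.+2) :: ps').
  by exists (rem (w, b.+2) ps); apply: perm_to_rem.
have spE z' : idgen (powers ps) z' <-> idgen (powers ((w, b.+2) :: ps')) z'.
  have hpp : perm_eq (powers ps) (powers ((w, b.+2) :: ps')) by apply: perm_map.
  by split; apply: idgen_subset => c; rewrite (perm_mem hpp).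
have hsum k : (k <= b.+2)%N ->
    (sumn (map snd ((w, k) :: ps')) + (b.+2 - k) = sumn (map snd ps))%N.
  by move=> lek; rewrite (perm_sumn (perm_map snd hps')) /=; lia.
have hpos' k : (0 < k)%N -> forall u, u \in (w, k) :: ps' -> (0 < u.2)%N.
  move=> k0 u; rewrite inE => /orP [/eqP -> //|ups]; apply: hpos.
  by rewrite (perm_mem hps') inE ups orbT.
have hp' : perm_eq (w :: map fst ps' ++ y :: r) xs.
  apply: perm_trans hp; rewrite perm_sym.
  have /= := perm_map fst hps'; move=> /(perm_cat) h.
  by have := h _ _ (perm_refl (y :: r)).
have hw : perm_eq (map fst ps' ++ w :: (y :: r)) xs.
  by apply: perm_trans hp'; rewrite -cat1s perm_catCA.
have IHk k : (0 < k)%N -> (k < b.+2)%N -> forall z,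
    idgen (powers ((w, k) :: ps')) (z * y) -> idgen (powers ((w, k) :: ps')) z.
  move=> k0 kb; apply: (IHn _ _ r); [|exact: hp'|exact: hpos'].
  by apply: leq_trans len; rewrite -(hsum k (ltnW kb)) -addn1 leq_add2l subn_gt0.
have IHw k z' : idgen (powers ps') (z' * w ^+ k) -> idgen (powers ps') z'.
  elim: k z' => [|k IHk'] z'; first by rewrite mulr1.
  rewrite exprSr mulrA => h; apply: IHk'.
  apply: (IHn _ w (y :: r)) h; [|exact: hw|].
    by apply: leq_trans len; rewrite -(hsum 0%N isT) -addn1 leq_add2l.
  by move=> u ups; apply: (hpos' 1%N) => //; rewrite inE ups orbT.
move=> /spE /= [c [j [_ sj e]]]; apply/spE.
(* From z = c1 w^(b+1) + j1 and z y = c w^(b+2) + j, cancelling w^(b+1) modulo the other powers puts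
   c1 y into the ideal of w and those powers. By induction c1 is there too, and z gains the missing
   factor w. *)
have [|c1 [j1 [_ sj1 e1]]] := IHk b.+1 isT (ltnSn _) z.
  by exists (c * w), j; split=> //; rewrite e exprS; ring.
have hpsI := idgen_ideal (powers ps').
have h2 : idgen (powers ps') (c1 * y - c * w).
  apply: (IHw b.+1).
  have -> : (c1 * y - c * w) * w ^+ b.+1 = j - y * j1.
    have : (c1 * w ^+ b.+1 + j1) * y = c * w ^+ b.+2 + j by rewrite -e1 -e.
    rewrite (exprS w b.+1) => h.
    have -> : (c1 * y - c * w) * w ^+ b.+1 =
      (c1 * w ^+ b.+1 + j1) * y - c * (w * w ^+ b.+1) - y * j1 by ring.
    by rewrite h; ring.
  by apply: idealB => //; apply: idealMl.
have [|c2 [j2 [_ sj2 e2]]] := IHk 1%N isT isT c1.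
  by exists c, (c1 * y - c * w); split=> //; rewrite expr1 /=; ring.
exists c2, (j2 * w ^+ b.+1 + j1); split=> //; last by rewrite e1 e2 /= !exprS; ring.
by apply: idealD => //; apply: idealMr.
Qed.

(** Parameters are raised to the power [q] one at a time. A relation y^(q-1) tau = c y^q + j allows
    y^(q-1) to be cancelled by [regular_powers], leaving tau in the ideal that contains y itself. *)
Lemma socle_notin q : (0 < q)%N ->
  ~ idgen [seq x ^+ q | x <- xs] (\prod_(x <- xs) x ^+ q.-1).
Proof.
move=> q0.
suff h l r : perm_eq (l ++ r) xs ->
    ~ idgen ([seq x ^+ q | x <- l] ++ r) (\prod_(x <- l) x ^+ q.-1).
  by have := h xs [::]; rewrite !cats0; apply.
elim: l r => [|y l IHl] r hp.
  rewrite big_nil /= => /= h; apply: (prime_not1 hm); apply/hxs; move: h.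
  by apply: idgen_subset => b; rewrite (perm_mem hp).
rewrite big_cons /= => -[c [j [_ sj e]]].
have hp' : perm_eq (l ++ y :: r) xs.
  by apply: perm_trans hp; rewrite -cat1s perm_catCA.
apply: (IHl (y :: r) hp').
pose ps := [seq (x, q) | x <- l] ++ [seq (x, 1%N) | x <- r].
have eps : powers ps = [seq x ^+ q | x <- l] ++ r.
  rewrite /powers map_cat -!map_comp; congr (_ ++ _).
  by rewrite -[RHS]map_id; apply: eq_map => x /=; rewrite expr1.
have hps : perm_eq (map fst ps ++ y :: [::]) xs.
  have -> : map fst ps = l ++ r by rewrite map_cat -!map_comp !map_id.
  apply: perm_trans hp'; rewrite -catA perm_cat2l cats1 perm_rcons //.
have hpos u : u \in ps -> (0 < u.2)%N.
  by rewrite mem_cat => /orP [] /mapP [x _ ->].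
have reg k z : idgen (powers ps) (z * y ^+ k) -> idgen (powers ps) z.
  elim: k z => [|k IHk] z; first by rewrite mulr1.
  by rewrite exprSr mulrA => /(regular_powers hps hpos) /IHk.
set tau := \prod_(_ <- l) _ in e *.
have : idgen (powers ps) (tau - c * y).
  apply: (reg q.-1); rewrite eps.
  suff -> : (tau - c * y) * y ^+ q.-1 = j by [].
  have eq1 : y ^+ q = y * y ^+ q.-1 by rewrite -exprS prednK.
  have -> : (tau - c * y) * y ^+ q.-1 = y ^+ q.-1 * tau - c * (y * y ^+ q.-1) by ring.
  by rewrite e eq1; ring.
rewrite eps => h.
rewrite -(subrK (c * y) tau); apply: idealD; first exact: idgen_ideal.
  by move: h; apply: idgen_subset => b; rewrite !mem_cat inE => /orP [->|->] //; rewrite !orbT.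
by apply: idealMl; [exact: idgen_ideal|apply: idgen_mem; rewrite mem_cat inE eqxx orbT].
Qed.

End Local.

(** An ideal M maximal subject to M and (f) meeting in m f contains a power of each generator x: the
    colons M : x^k stabilize, so adding x^k keeps the condition. Hence f is in M, so f is in m f and
    vanishes. *)
Lemma krull_intersection m xs f : (forall a, ~ m a -> exists b, b * a = 1) ->
  is_prime_ideal m -> (forall z, m z <-> idgen xs z) ->
  (forall n, idgen [seq x ^+ n | x <- xs] f) -> f = 0.
Proof.
move=> hloc hm hxs hf; have im := prime_ideal hm.
pose mf : set A := fun z => exists2 r, m r & z = r * f.
have hmf : is_ideal mf.
  split; first by exists 0; rewrite ?mul0r //; apply: ideal0.
  split=> [_ _ [r mr ->] [r' mr' ->]|a _ [r mr ->]].
    by exists (r + r'); [exact: idealD|ring].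
  by exists (a * r); [exact: idealMl|ring].
have [||M [iM hM] [mfM Mmax]] :=
  @max_ideal _ hN [set K | is_ideal K /\ forall r : A, K (r * f) -> mf (r * f)] mf.
- by [].
- by move=> K [].
have hx x : x \in xs -> exists k, M (x ^+ k).
  move=> xxs; have mx : m x by apply/hxs/idgen_mem.
  have [|k|k hk] := @acc _ hN (fun k => colon M (x ^+ k)).
  - by move=> k; apply: colon_ideal.
  - by move=> z; rewrite /colon exprS mulrCA => ?; apply: idealMl.
  exists k; apply: (Mmax (adj M (x ^+ k))).
  - split; first exact: adj_ideal.
    move=> r [y [_ [My [c ->] e]]]; apply: hM; rewrite e.
    apply: idealD => //; apply: (hk k.+1 (leqnSn k) c); rewrite /colon exprSr.
    have -> : c * (x ^+ k * x) = x * (r * f) - x * y by rewrite e; ring.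
    apply: idealB => //; last exact: idealMl.
    by apply: mfM; exists (x * r); [exact: idealMr|ring].
  - exact: adj_sub_l.
  - exact: adj_mem.
have [n hn] : exists n, forall x, x \in xs -> M (x ^+ n).
  elim: {hxs hf} xs hx => [|x s IHs] hx; first by exists 0.
  have [|n hn] := IHs; first by move=> y ys; apply: hx; rewrite inE ys orbT.
  have [k hk] := hx x (mem_head _ _); exists (k + n)%N => y.
  rewrite inE exprD => /orP [/eqP ->|/hn ?]; [exact: idealMr|exact: idealMl].
have : M (1 * f).
  rewrite mul1r; apply: idgen_sub (hf n) => // _ /mapP [x xxs ->]; exact: hn.
move=> /hM [r mr]; rewrite mul1r => e.
have [|b hb] := hloc (1 - r).
  by move=> h; apply: (prime_not1 hm); rewrite -(subrK r 1); apply: idealD.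
by rewrite -(mul1r f) -hb -mulrA mulrBl mul1r -e subrr mulr0.
Qed.

Lemma is_local_units m : is_local_ring m ->
  is_prime_ideal m /\ forall a, ~ m a -> exists b, b * a = 1.
Proof.
move=> [[im [m1 mmax]] muniq].
have hloc a : ~ m a -> exists b, b * a = 1.
  move=> ma; apply: contrapT => hno.
  have [||M [iM M1] [aM Mmax]] := @max_ideal _ hN [set K | is_ideal K /\ ~ K 1]
     (fun z => exists c, z = c * a).
  - split; first exact: mul_ideal.
    by move=> [r e]; apply: hno; exists r.
  - by move=> K [].
  apply: ma; apply/(muniq M); last by apply: aM; exists 1; rewrite mul1r.
  split=> //; split=> // J iJ MJ; have [J1|J1] := pselect (J 1); [by right|left=> x].
  by split; [exact: Mmax|exact: MJ].
split=> //; split=> //; split=> // a b mab.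
apply: contrapT => /not_orP [/hloc [c ca] /hloc [d db]]; apply: m1.
have -> : 1 = (d * c) * (a * b) by rewrite -{1}db -(mul1r (d * b)) -ca; ring.
exact: idealMl.
Qed.

End RegularSequences.

(** * Completion *)

Section AdicFiltration.
Variables (A : comNzRingType) (xs : seq A).

Fixpoint mpow n : set A := if n is n'.+1 then lincomb (mpow n') xs else setT.

Lemma mpow_ideal n : is_ideal (mpow n).
Proof. by elim: n => [|n IHn]; [exact: idealT|exact: lincomb_ideal]. Qed.

Lemma mpow0 n : mpow n 0. Proof. exact: ideal0 (mpow_ideal n). Qed.

Lemma mpowS n : mpow n.+1 `<=` mpow n.
Proof. by apply: lincomb_sub => [|r b mr _]; [exact: mpow_ideal|apply: idealMr => //;
  exact: mpow_ideal]. Qed.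

Lemma mpow_le n k : (n <= k)%N -> mpow k `<=` mpow n.
Proof. by apply: desc_le; apply: mpowS. Qed.

Lemma mpow1 n x y : mpow n x -> idgen xs y -> mpow n.+1 (x * y).
Proof. by apply: lincomb_mul; apply: mpow_ideal. Qed.

Lemma mpowX n x : x \in xs -> mpow n (x ^+ n).
Proof.
move=> xxs; elim: n => [|n IHn] //; rewrite exprSr; apply: mpow1 => //; exact: idgen_mem.
Qed.

Lemma mpow_sub n J : is_ideal J ->
  (forall us, size us = n -> (forall u, u \in us -> idgen xs u) -> J (\prod_(u <- us) u)) ->
  mpow n `<=` J.
Proof.
elim: n J => [|n IHn] J hJ h.
  by move=> z _; apply: ideal_full => //; have := h [::] erefl; rewrite big_nil; apply.
apply: lincomb_sub => // r b mr bxs.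
apply: (IHn (colon J b)) mr => [|us sus hus]; first exact: colon_ideal.
have := h (b :: us); rewrite /= sus big_cons /colon mulrC; apply=> // u.
by rewrite inE => /orP [/eqP ->|/hus //]; apply: idgen_mem.
Qed.

Lemma mpow_sub_powers q : exists N, mpow N `<=` idgen [seq x ^+ q | x <- xs].
Proof.
have hI : is_ideal (idgen [seq x ^+ q | x <- xs]) by exact: idgen_ideal.
have [|N hN] := @prod_in_ideal _ xs _ hI.
  by move=> b bxs; exists q; apply: idgen_mem; apply/mapP; exists b.
by exists N; apply: mpow_sub => // us sus hus; apply: hN; rewrite ?sus.
Qed.

(** Cauchy sequences are normalized so that [u n] is already correct modulo the n-th power; no
    modulus of convergence appears. *)
Definition adic_cauchy (u : nat -> A) := forall n, mpow n (u n.+1 - u n).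
Definition adic_complete := forall u, adic_cauchy u ->
  exists l, forall n, mpow n (l - u n).
Definition adic_separated := forall z, (forall n, mpow n z) -> z = 0.
Definition locally_units := forall a, ~ idgen xs a -> exists b, b * a = 1.

Lemma cauchy_le u n k : adic_cauchy u -> (n <= k)%N -> mpow n (u k - u n).
Proof.
move=> hu; elim: k => [|k IHk].
  by rewrite leqn0 => /eqP ->; rewrite subrr; exact: mpow0.
rewrite leq_eqVlt => /orP [/eqP <-|lenk]; first by rewrite subrr; exact: mpow0.
rewrite -(subrKA (u k)); apply: idealD; [exact: mpow_ideal|exact: mpow_le (hu k)|exact: IHk].
Qed.

End AdicFiltration.

(** * Noetherianity of complete rings *)

Section CompleteNoetherian.
Variables (S : comNzRingType) (ys : seq S).
Hypothesis hu : locally_units ys.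
Hypothesis hc : adic_complete ys.
Hypothesis hs : adic_separated ys.

(** The coefficients of each generator form a convergent series, so a finitely generated ideal is
    closed under series whose coefficients tend to 0. *)
Lemma series_in_idgen s (t : nat -> S) : (forall n, lincomb (mpow ys n) s (t n)) ->
  exists2 T, idgen s T & forall n, mpow ys n (T - \sum_(j < n) t j).
Proof.
elim: s t => [|b s IHs] t ht.
  exists 0 => // n; rewrite big1 => [|i _]; last exact: ht.
  by rewrite subrr; exact: mpow0.
have [ry hry] := choice (fun n => let: ex_intro r h := ht n in
  let: ex_intro y h' := h in ex_intro (fun ry : S * S =>
    [/\ mpow ys n ry.1, lincomb (mpow ys n) s ry.2 & t n = ry.1 * b + ry.2]) (r, y) h').
have [|rho hrho] := hc (u := fun n => \sum_(j < n) (ry j).1).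
  by move=> n; rewrite big_ord_recr /= addrAC subrr add0r; have [] := hry n.
have [|T sT hT] := IHs (fun n => (ry n).2); first by move=> n; have [] := hry n.
exists (rho * b + T); first by exists rho, T.
move=> n; rewrite (eq_bigr (fun j : 'I_n => (ry j).1 * b + (ry j).2)); last first.
  by move=> i _; have [_ _] := hry i.
rewrite big_split /= -mulr_suml opprD addrACA -mulrBl.
by apply: idealD => //; [exact: mpow_ideal|apply: idealMr => //; exact: mpow_ideal].
Qed.

(* Hilbert's basis argument on the leading coefficients in powers of x, one
   generator x of the maximal ideal at a time. *)
Lemma complete_noeth_step I x : is_ideal I -> x \in ys ->
  (forall J, is_ideal J -> I `<=` J -> J x -> fg J) -> fg I.
Proof.
move=> hI xys hJ.
(* [C n] is the ideal of leading coefficients: those [a] with [a * x ^+ n] in [I + (x ^+ n.+1)]. It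
   contains [I] and [x], so the hypothesis makes it finitely generated, and likewise the union of
   all of them. *)
pose C n := colon (adj I (x ^+ n.+1)) (x ^+ n).
have hC n : is_ideal (C n) by apply/colon_ideal/adj_ideal.
have IC n : I `<=` C n.
  by move=> z Iz; rewrite /C /colon; apply: adj_sub_l; apply: idealMr.
have Cx n : C n x by rewrite /C /colon -exprS; apply: adj_mem.
have CS n : C n `<=` C n.+1.
  move=> z [i [_ [Ii [c ->] e]]]; exists (i * x), (c * x ^+ n.+2); split.
  - exact: idealMr.
  - by exists c.
  - by rewrite (exprSr x n) mulrA e (exprSr x n.+1); ring.
have [N hN] : exists N, forall n, (N <= n)%N -> C n `<=` C N.
  apply: asc_stable => //; apply: hJ; first exact: asc_ideal.
    by move=> z Iz; exists 0; apply: IC.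
  by exists 0; apply: Cx.
pose In n : set S := I `&` (fun z => exists c, z = c * x ^+ n).
have InS n : is_ideal (In n) by apply: setI_ideal => //; apply: mul_ideal.
have lift n : exists s, (forall b, b \in s -> I b) /\
    forall a, C n a -> exists2 t, idgen s t & exists c, a * x ^+ n - t = c * x ^+ n.+1.
  have [g hg] := hJ (C n) (hC n) (IC n) (Cx n).
  suff [s [hsI hs']] : exists s, (forall b, b \in s -> I b) /\
      forall a, idgen g a -> exists2 t, idgen s t & exists c, a * x ^+ n - t = c * x ^+ n.+1.
    by exists s; split=> // a /hg /hs'.
  have : forall a, a \in g -> C n a by move=> a ag; apply/hg/idgen_mem.
  elim: {hg} g => [|a g IHg] hga.
    exists [::]; split=> // a -> ; exists 0; first by [].
    by exists 0; rewrite !mul0r subrr.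
  have [|s [hsI hs']] := IHg; first by move=> b bg; apply: hga; rewrite inE bg orbT.
  have [i [_ [Ii [c ->] e]]] := hga a (mem_head _ _).
  exists (i :: s); split=> [b|b [r [y [_ gy ->]]]].
    by rewrite inE => /orP [/eqP ->|/hsI].
  have [t st [c' e']] := hs' y gy; exists (r * i + t); first by exists r, t.
  exists (r * c + c'); rewrite [RHS]mulrDl -e'.
  have -> : (r * a + y) * x ^+ n - (r * i + t) = r * (a * x ^+ n) - r * i + (y * x ^+ n - t)
    by ring.
  by rewrite e; ring.
have [L hL] := choice lift.
have LI n : idgen (L n) `<=` I by apply: idgen_sub => //; apply: (hL n).1.
pose LL n := flatten [seq L k | k <- iota 0 n].
have LLI n : idgen (LL n) `<=` I.
  apply: idgen_sub => // b /flatten_mapP [k _]; exact: (hL k).1.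
have LL_S n : idgen (LL n) `<=` idgen (LL n.+1).
  by apply: idgen_subset => b; rewrite /LL -addn1 iotaD map_cat flatten_cat mem_cat => ->.
have L_S n : idgen (L n) `<=` idgen (LL n.+1).
  apply: idgen_subset => b; rewrite /LL -addn1 iotaD map_cat flatten_cat mem_cat /=.
  by rewrite cats0 add0n => ->; rewrite orbT.
have phase1 n z : I z -> exists2 t, idgen (LL n) t & In n (z - t).
  move=> Iz; elim: n => [|n [t st [Izt [c e]]]].
    by exists 0; rewrite // subr0; split=> //; exists z; rewrite mulr1.
  have Cc : C n c by rewrite /C /colon -e; apply: adj_sub_l.
  have [t' st' [c' e']] := (hL n).2 c Cc.
  exists (t + t'); first by apply: idealD; [exact: idgen_ideal|exact: LL_S|exact: L_S].
  rewrite opprD addrA; split; first by apply: idealB => //; exact: LI st'.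
  by exists c'; rewrite e.
(* From order [N] on all leading coefficients lie in [C N], so [x ^+ j] times combinations of [L N]
   suffices. The coefficients tend to 0 and the corrections form a convergent series. *)
have phase2 j z : In (N + j)%N z -> exists2 t, lincomb (mpow ys j) (L N) t & In (N + j).+1 (z
  - t).
  move=> [Iz [c ez]].
  have CNc : C N c.
    by apply: (hN (N + j)%N); [exact: leq_addr|rewrite /C /colon -ez; apply: adj_sub_l].
  have [t st [c' e']] := (hL N).2 c CNc.
  exists (x ^+ j * t); first by apply: lincomb_mul => //; [exact: mpow_ideal|exact: mpowX].
  split; first by apply: idealB => //; apply: idealMl => //; exact: LI st.
  by exists c'; rewrite ez -addSn (exprD x N.+1) mulrA -e' exprD; ring.
exists (LL N.+1) => z; split=> [Iz|]; last exact: LLI.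
have [t0 st0 Inz0] := phase1 N z Iz.
have {}phase2 (jz : nat * S) : exists t, In (N + jz.1)%N jz.2 ->
    lincomb (mpow ys jz.1) (L N) t /\ In (N + jz.1).+1 (jz.2 - t).
  have [/phase2 [t]|] := pselect (In (N + jz.1)%N jz.2); first by exists t.
  by exists 0.
have [f hf] := choice phase2.
pose u := fix u j := if j is j'.+1 then u j' - f (j', u j') else z - t0.
have hu' j : In (N + j)%N (u j).
  by elim: j => [|j IHj]; rewrite ?addn0 // addnS; apply: (hf (j, u j) IHj).2.
have [|T sT hT] := @series_in_idgen (L N) (fun j => f (j, u j)).
  by move=> j; apply: (hf (j, u j) (hu' j)).1.
have eu j : u j = z - t0 - \sum_(i < j) f (val i, u (val i)).
  elim: j => [|j IHj]; first by rewrite big_ord0 subr0.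
  by rewrite big_ord_recr /= {1}IHj; ring.
have -> : z = t0 + T.
  apply/eqP; rewrite -subr_eq0; apply/eqP/hs => n.
  have -> : z - (t0 + T) = u n - (T - \sum_(i < n) f (val i, u (val i))).
    by rewrite eu; ring.
  apply: idealB => //; first exact: mpow_ideal.
  have [_ [c ->]] := hu' n; rewrite exprD mulrA.
  by apply: idealMl; [exact: mpow_ideal|exact: mpowX].
apply: idealD; [exact: idgen_ideal| |exact: L_S].
move: st0; apply: idgen_subset => b; rewrite /LL -addn1 iotaD map_cat flatten_cat mem_cat.
by move=> ->.
Qed.

(** Induction on the number of generators [ys] not yet known to lie in the ideal; an ideal
    containing all of them is the maximal ideal or the unit ideal. *)
Theorem complete_noeth : noeth S.
Proof.
suff h s pre : ys = pre ++ s -> forall I, is_ideal I -> (forall b, b \in pre -> I b) -> fg I.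
  by move=> I hI; apply: (h ys [::]).
elim: s pre => [|x s IHs] pre eys I hI hpre.
  rewrite cats0 in eys; rewrite -eys in hpre.
  have [Iys|] := pselect (I `<=` idgen ys).
    by exists ys => z; split; [exact: Iys|exact: idgen_sub].
  move=> /existsNP [z /not_implyP [Iz /hu [b hb]]].
  exists [:: 1] => w; split=> _; last by apply: ideal_full => //; rewrite -hb; apply: idealMl.
  by exists w, 0; rewrite mulr1 addr0.
apply: (@complete_noeth_step _ x) => //; first by rewrite eys mem_cat inE eqxx orbT.
move=> J iJ IJ Jx; apply: (IHs (rcons pre x)) => //; first by rewrite cat_rcons.
by move=> b; rewrite mem_rcons inE => /orP [/eqP -> //|/hpre /IJ].
Qed.

End CompleteNoetherian.

(** * Construction of the completion *)

Section Completion.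
Variables (A : comNzRingType) (xs : seq A).

(** The inverse limit of the A/m^n is realized by sequences of representatives modulo null
    sequences, so that the quotients A/m^n are never formed. *)
Definition coherent : {pred (nat -> A)} :=
  fun a => `[< forall n, mpow xs n (a n.+1 - a n) >].

Lemma coherentP (a : nat -> A) :
  reflect (forall n, mpow xs n (a n.+1 - a n)) (a \in coherent).
Proof. exact: asboolP. Qed.

Lemma coherent_subring : subring_closed coherent.
Proof.
split=> [|a b /coherentP ha /coherentP hb|a b /coherentP ha /coherentP hb].
- by apply/coherentP => n; rewrite subrr; apply: mpow0.
- apply/coherentP => n; change (mpow xs n ((a n.+1 - b n.+1) - (a n - b n))).
  have -> : (a n.+1 - b n.+1) - (a n - b n) = (a n.+1 - a n) - (b n.+1 - b n) by ring.
  by apply: idealB => //; apply: mpow_ideal.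
- apply/coherentP => n; change (mpow xs n (a n.+1 * b n.+1 - a n * b n)).
  have -> : a n.+1 * b n.+1 - a n * b n =
    (a n.+1 - a n) * b n.+1 + a n * (b n.+1 - b n) by ring.
  by apply: idealD; [exact: mpow_ideal|apply: idealMr => //|apply: idealMl => //];
    exact: mpow_ideal.
Qed.
HB.instance Definition _ := GRing.isSubringClosed.Build (nat -> A) coherent coherent_subring.

Record cohseq := Cohseq { cohval :> nat -> A; _ : cohval \in coherent }.
HB.instance Definition _ := [isSub for cohval].
HB.instance Definition _ := [Choice of cohseq by <:].
HB.instance Definition _ := [SubChoice_isSubComNzRing of cohseq by <:].

Lemma cohD (a b : cohseq) n : (a + b) n = a n + b n. Proof. by []. Qed.
Lemma cohM (a b : cohseq) n : (a * b) n = a n * b n. Proof. by []. Qed.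
Lemma cohN (a : cohseq) n : (- a) n = - a n. Proof. by []. Qed.
Lemma coh0 n : (0 : cohseq) n = 0. Proof. by []. Qed.
Lemma coh1 n : (1 : cohseq) n = 1. Proof. by []. Qed.
Lemma cohP (a : cohseq) n : mpow xs n (a n.+1 - a n).
Proof. by case: a => a /= /coherentP. Qed.

Definition nullseq : {pred cohseq} := fun a => `[< forall n, mpow xs n (a n) >].
Lemma nullP (a : cohseq) : reflect (forall n, mpow xs n (a n)) (a \in nullseq).
Proof. exact: asboolP. Qed.

Lemma nullseq_ideal : ~ idgen xs 1 -> idealr_closed nullseq.
Proof.
move=> m1; split.
- by apply/nullP => n; apply: mpow0.
- apply/negP => /nullP /(_ 1%N); rewrite coh1 => h; apply: m1.
  by apply: lincomb_sub h => [|r b _ bxs]; [exact: idgen_ideal|apply: idealMl;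
    [exact: idgen_ideal|exact: idgen_mem]].
- move=> a u v /nullP hu /nullP hv; apply/nullP => n; rewrite cohD cohM.
  by apply: idealD; [exact: mpow_ideal|apply: idealMl => //; exact: mpow_ideal|].
Qed.

Lemma const_coherent (a : A) : (fun=> a) \in coherent.
Proof. by apply/coherentP => n; rewrite subrr; apply: mpow0. Qed.
Definition constseq a := Cohseq (const_coherent a).

Lemma constseq_zmod : zmod_morphism constseq.
Proof. by move=> a b; apply: val_inj; apply: funext => n. Qed.
Lemma constseq_monoid : monoid_morphism constseq.
Proof. by split=> [|a b]; apply: val_inj; apply: funext => n. Qed.
HB.instance Definition _ := GRing.isZmodMorphism.Build A cohseq constseq constseq_zmod.
HB.instance Definition _ := GRing.isMonoidMorphism.Build A cohseq constseq constseq_monoid.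

(** Truncated subtraction keeps the sequence equal to [d 0] up to index n. The term [d j] with j > 0
    enters at index n + j, which requires it in the power n + j - 1. *)
Lemma partial_sums_coherent n (d : nat -> A) :
  (forall j, mpow xs (n + j.-1) (d j)) ->
  (fun k => \sum_(j < (k - n).+1) d j) \in coherent.
Proof.
move=> hd; apply/coherentP => k; have [lenk|ltkn] := leqP n k.
  rewrite subSn // [X in X - _]big_ord_recr /= addrAC subrr add0r.
  by have := hd (k - n).+1; rewrite /= subnKC.
have -> : (k.+1 - n = k - n)%N by lia.
by rewrite subrr; apply: mpow0.
Qed.

Section Quotient.
Variables (S : comNzRingType) (pi : {rmorphism cohseq -> S}).
Hypothesis pi_surj : forall s, exists a, s = pi a.
Hypothesis pi_eq0 : forall a, pi a = 0 <-> a \in nullseq.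
Let i (a : A) := pi (constseq a).
Let ys := map i xs.

Lemma lincomb_completion n s d (hd : forall j, mpow xs (n + j.-1) (d j)) :
  (forall c : cohseq, mpow xs n (c n) -> mpow ys n (pi c)) ->
  (forall j, lincomb (mpow xs (n + j.-1)) s (d j)) ->
  lincomb (mpow ys n) (map i s) (pi (Cohseq (partial_sums_coherent hd))).
Proof.
move=> hn; elim: s d hd => [|b s IHs] d hd hs /=.
  apply/pi_eq0/nullP => k; rewrite /= big1 => [|j _]; [exact: mpow0|exact: hs].
have [ry hry] := choice (fun j => let: ex_intro r h := hs j in
  let: ex_intro y h' := h in ex_intro (fun ry : A * A =>
    [/\ mpow xs (n + j.-1) ry.1, lincomb (mpow xs (n + j.-1)) s ry.2 & d j = ry.1 * b +
      ry.2]) (r, y) h').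
have hr j : mpow xs (n + j.-1) (ry j).1 by have [] := hry j.
have hsy j : lincomb (mpow xs (n + j.-1)) s (ry j).2 by have [] := hry j.
have hy j : mpow xs (n + j.-1) (ry j).2.
  apply: lincomb_sub (hsy j) => [|r c mr _]; first exact: mpow_ideal.
  by apply: idealMr => //; apply: mpow_ideal.
exists (pi (Cohseq (partial_sums_coherent hr))), (pi (Cohseq (partial_sums_coherent hy))).
split; [|exact: IHs|].
  by apply: hn; rewrite /= subnn big_ord1; have := hr 0%N; rewrite addn0.
rewrite /i -rmorphM -rmorphD; congr (pi _); apply: val_inj; apply: funext => k /=.
rewrite [RHS](_ : _ = (\sum_(j < (k - n).+1) (ry j).1) * b + \sum_(j < (k - n).+1) (ry j).2) //.
rewrite mulr_suml -big_split /=; apply: eq_bigr => j _.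
by have [] := hry j.
Qed.

(** For the converse [c] is written as the series of its successive differences. Each is expanded in
    the generators, and for each generator the coefficients add up to a coherent sequence. *)
Lemma mpow_completion n (c : cohseq) : mpow ys n (pi c) <-> mpow xs n (c n).
Proof.
split.
  suff h n' s : mpow ys n' s -> exists2 a, s = pi a & mpow xs n' (a n').
    move=> /h [a epi ma].
    have : c - a \in nullseq by apply/pi_eq0; rewrite rmorphB epi subrr.
    move=> /nullP /(_ n) hca; rewrite -(subrK (a n) (c n)).
    by apply: idealD => //; apply: mpow_ideal.
  elim: n' s => [|n' IHn] s; first by have [a ->] := pi_surj s; exists a.
  move: s; apply: lincomb_sub.
    split; first by exists 0; rewrite ?rmorph0 // coh0; apply: mpow0.
    split=> [_ _ [a -> ma] [b -> mb]|x _ [a -> ma]].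
      by exists (a + b); rewrite ?rmorphD // cohD; apply: idealD => //; apply: mpow_ideal.
    have [b ->] := pi_surj x.
    by exists (b * a); rewrite ?rmorphM // cohM; apply: idealMl => //; apply: mpow_ideal.
  move=> r _ /IHn [a -> ma] /mapP [x xxs ->].
  exists (a * constseq x); first by rewrite rmorphM.
  rewrite cohM; apply: mpow1; last exact: idgen_mem.
  rewrite -(subrK (a n') (a n'.+1)); apply: idealD => //; first exact: mpow_ideal.
  exact: cohP.
elim: n c => [|n IHn] c hc //.
pose d j := if j is j'.+1 then c (n + j).+1 - c (n + j)%N else c n.+1.
have hs j : lincomb (mpow xs (n + j.-1)) xs (d j).
  case: j => [|j] /=; first by rewrite addn0.
  by have := cohP c (n + j.+1); rewrite {1}addnS.
have hd j : mpow xs (n + j.-1) (d j).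
  apply: lincomb_sub (hs j) => [|r b mr _]; first exact: mpow_ideal.
  by apply: idealMr => //; apply: mpow_ideal.
have := lincomb_completion hd IHn hs.
suff -> : pi c = pi (Cohseq (partial_sums_coherent hd)) by [].
apply/eqP; rewrite -subr_eq0 -rmorphB; apply/eqP/pi_eq0/nullP => k.
rewrite cohD cohN /=.
have hsum j : \sum_(l < j.+1) d l = c (n + j).+1.
  elim: j => [|j IHj]; first by rewrite big_ord1 addn0.
  by rewrite big_ord_recr /= IHj addnS; ring.
rewrite hsum -opprB; apply: idealN; first exact: mpow_ideal.
apply: (@cauchy_le _ xs c) => [j|]; first exact: cohP.
by lia.
Qed.

Lemma completion_density n s : exists a, mpow ys n (s - i a).
Proof.
have [c ->] := pi_surj s; exists (c n); rewrite /i -rmorphB.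
by apply/mpow_completion; rewrite cohD cohN /= subrr; apply: mpow0.
Qed.

Lemma completion_units : locally_units xs -> locally_units ys.
Proof.
move=> hloc s; have [c ->] := pi_surj s => hc.
have cu n : ~ idgen xs (c n.+1).
  move=> h; apply: hc; apply: (proj2 (mpow_completion 1 c)).
  have -> : c 1%N = c n.+1 - (c n.+1 - c 1%N) by ring.
  apply: idealB => //; first exact: mpow_ideal.
  by apply: (@cauchy_le _ xs c) => // j; apply: cohP.
have [b hb] := choice (fun n => hloc _ (cu n)).
(* Entry 0 of a coherent sequence carries no information, and only later entries of [c] are known to
   be units; hence the shift and the arbitrary value 0. *)
have hbc : (fun n => if n is n'.+1 then b n' else 0) \in coherent.
  apply/coherentP => -[|n] //.
  have -> : b n.+1 - b n = (b n.+1 * b n) * - (c n.+2 - c n.+1).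
    have -> : (b n.+1 * b n) * - (c n.+2 - c n.+1) =
       b n.+1 * (b n * c n.+1) - b n * (b n.+1 * c n.+2) by ring.
    by rewrite !hb; ring.
  by apply: idealMl; [|apply: idealN]; [exact: mpow_ideal..|exact: cohP].
exists (pi (Cohseq hbc)); apply/eqP.
rewrite -rmorphM -(rmorph1 pi) -subr_eq0 -rmorphB; apply/eqP/pi_eq0/nullP => -[|n] //.
by rewrite cohD cohN cohM coh1 /= hb subrr; exact: (mpow0 xs n.+1).
Qed.

Lemma completion_complete : adic_complete ys.
Proof.
move=> u hu; have [a ha] := choice (fun n => pi_surj (u n)).
have hd n : mpow xs n (a n.+1 n - a n n).
  by have := hu n; rewrite !ha -rmorphB => /mpow_completion.
have hl : (fun n => a n n) \in coherent.
  apply/coherentP => n; rewrite -(subrKA (a n.+1 n)).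
  by apply: idealD => //; [exact: mpow_ideal|exact: cohP].
exists (pi (Cohseq hl)) => n; rewrite ha -rmorphB; apply/mpow_completion.
by rewrite cohD cohN /= subrr; apply: mpow0.
Qed.

Lemma completion_separated : adic_separated ys.
Proof.
move=> s hs; have [c ec] := pi_surj s; rewrite ec in hs *.
by apply/pi_eq0/nullP => n; apply/mpow_completion; apply: hs.
Qed.

End Quotient.

(** The last two clauses, density and contraction, identify S/m^n S with A/m^n; through them
    Frobenius powers contract back to [A]. *)
Theorem completion : ~ idgen xs 1 -> locally_units xs ->
  exists (S : comNzRingType) (i : {rmorphism A -> S}), let ys := map i xs in
  [/\ ~ idgen ys 1, locally_units ys, adic_complete ys & adic_separated ys] /\
  (forall n s, exists a, mpow ys n (s - i a)) /\
  (forall n a, mpow ys n (i a) -> mpow xs n a).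
Proof.
move=> m1 hloc.
pose N : idealr cohseq := HB.pack (nullseq : cohseq -> bool) (isIdealr.Build _ _
  (nullseq_ideal m1)).
pose S : comNzRingType := Quotient.quot N.
pose pi : {rmorphism cohseq -> S} := \pi_S%qT.
have pi_surj s : exists a, s = pi a by exists (repr s); rewrite /pi /= reprK.
have pi_eq0 a : pi a = 0 <-> a \in nullseq.
  have e : (a \in nullseq) = (pi a == pi 0) by have := Quotient.idealrBE N a 0;
    rewrite subr0; apply.
  by rewrite e rmorph0; split=> [->|/eqP //]; rewrite eqxx.
exists S, (pi \o constseq : {rmorphism A -> S}) => ys.
have eys : ys = map (fun a => pi (constseq a)) xs by [].
split; [split|split].
- move=> h; apply: (m1); have := proj1 (mpow_completion pi_surj pi_eq0 1 1);
  rewrite rmorph1 coh1.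
  by apply.
- exact: completion_units.
- exact: completion_complete.
- exact: completion_separated.
- exact: completion_density.
- by move=> n a /(mpow_completion pi_surj pi_eq0 n (constseq a)).
Qed.

End Completion.

(** * Lengths and flatness of Frobenius *)

Lemma nat_min (P : nat -> Prop) : (exists n, P n) ->
  exists2 n, P n & forall k, P k -> (n <= k)%N.
Proof.
case=> n Pn; have hex : exists n, `[< P n >] by exists n; apply/asboolP.
case: (ex_minnP hex) => k /asboolP Pk hk; exists k => // j Pj.
by apply: hk; apply/asboolP.
Qed.

Lemma nat_max (P : nat -> Prop) B : (exists n, P n) -> (forall n, P n -> (n <= B)%N) ->
  exists2 n, P n & forall k, P k -> (k <= n)%N.
Proof.
case=> n Pn hB; have hex : exists n, `[< P n >] by exists n; apply/asboolP.
have hB' k : `[< P k >] -> (k <= B)%N by move=> /asboolP /hB.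
case: (ex_maxnP hex hB') => k /asboolP Pk hk; exists k => // j Pj.
by apply: hk; apply/asboolP.
Qed.

Section Length.
Variables (A : comNzRingType) (xs : seq A).
Implicit Types (I J K L : set A).
Hypothesis hloc : locally_units xs.

(* The colength of L in A is at most n: y may already lie in L. *)
Fixpoint lenle n L : Prop :=
  if n is n'.+1 then exists y, (forall x, idgen xs x -> L (x * y)) /\ lenle n' (adj L y)
  else L 1.

Lemma adjS L L' y : L `<=` L' -> adj L y `<=` adj L' y.
Proof. by move=> h _ [i [j [/h Li hj ->]]]; exists i, j. Qed.

Lemma lenle_mono n L L' : L `<=` L' -> lenle n L -> lenle n L'.
Proof.
elim: n L L' => [|n IHn] L L' LL' /=; first exact: LL'.
by case=> y [hy hn]; exists y; split=> [x /hy /LL' //|]; apply: IHn hn; apply: adjS.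
Qed.

(** Along the chain of adjoined elements [y], the element [u] is absorbed at some step. Its
    coefficient on [y] is then a unit, so [y] already lies in the ideal grown from [L'] and that
    step is saved. *)
Lemma lenle_strict n L L' u : is_ideal L -> is_ideal L' -> L `<=` L' -> L' u -> ~ L u ->
  lenle n.+1 L -> lenle n L'.
Proof.
elim: n L L' => [|n IHn] L L' hL hL' LL' L'u Lu [y [hy hn]].
  have [i [_ [Li [r ->] e]]] := ideal_full (adj_ideal y hL) hn u.
  have [mr|/hloc [b hb]] := pselect (idgen xs r).
    by exfalso; apply: Lu; rewrite e; apply: idealD => //; apply: hy.
  have L'y : L' y.
    have -> : y = b * (u - i) by rewrite e addrC addKr mulrA hb mul1r.
    by apply: idealMl => //; apply: idealB => //; apply: LL'.
  by apply: adj_sub hn.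
have [[i [_ [Li [r ->] e]]]|nu] := pselect (adj L y u); last first.
  exists y; split=> [x /hy /LL' //|].
  apply: (IHn (adj L y)) => //;
    [exact: adj_ideal|exact: adj_ideal|exact: adjS|exact: adj_sub_l].
have [mr|/hloc [b hb]] := pselect (idgen xs r).
  by exfalso; apply: Lu; rewrite e; apply: idealD => //; apply: hy.
have L'y : L' y.
  have -> : y = b * (u - i) by rewrite e addrC addKr mulrA hb mul1r.
  by apply: idealMl => //; apply: idealB => //; apply: LL'.
by apply: (@lenle_mono n.+1 (adj L y)) => //; apply: adj_sub.
Qed.

(** Additivity along 0 -> A/(L : y) -> A/L -> A/(L + (y)) -> 0. A chain element v = l + r y
    contributes r to the colon; any other contributes to L + (y). *)
Lemma lenle_split n L y : is_ideal L -> lenle n L ->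
  exists a b, [/\ (a + b <= n)%N, lenle a (adj L y) & lenle b (colon L y)].
Proof.
elim: n L => [|n IHn] L hL /=.
  move=> L1; exists 0%N, 0%N; split=> //; first exact: adj_sub_l.
  exact: (ideal_full hL L1 (1 * y)).
case=> v [hv hn]; have hL1 := adj_ideal v hL.
have [a [b [leab ha hb]]] := IHn _ hL1 hn.
have [[l [_ [Ll [r ->] ev]]]|nv] := pselect (adj L y v).
  exists a, b.+1; split; first by rewrite addnS.
    apply: lenle_mono ha; apply: adj_sub; [exact: adj_ideal| |exact: adj_mem].
    apply: adj_sub; [exact: adj_ideal|exact: adj_sub_l|].
    by exists l, (r * y); split=> //; exists r.
  exists r; split=> [x mx|].
    rewrite /colon; have -> : x * r * y = x * v - x * l by rewrite ev; ring.
    by apply: idealB => //; [exact: hv|exact: idealMl].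
  apply: lenle_mono hb => z [l' [_ [Ll' [s ->] e]]].
  exists (z - s * r), (s * r); split; [|by exists s|by ring].
  rewrite /colon; have -> : (z - s * r) * y = l' + s * l by rewrite mulrBl e ev; ring.
  by apply: idealD => //; apply: idealMl.
exists a.+1, b; split; first by rewrite addSn.
  exists v; split=> [x mx|]; first by apply: adj_sub_l; apply: hv.
  apply: lenle_mono ha; apply: adj_sub; first exact/adj_ideal/adj_ideal.
    by apply: adjS; apply: adj_sub_l.
  by apply: adj_sub_l; apply: adj_mem.
apply: lenle_mono hb => z [l [_ [Ll [s ->] e]]]; rewrite /colon e.
apply: idealD => //; have [/hv //|/hloc [c hc]] := pselect (idgen xs s).
exfalso; apply: nv.
have -> : v = c * (z * y - l) by rewrite e addrC addKr mulrA hc mul1r.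
exists (- (c * l)), (c * z * y); split; [|by exists (c * z)|by ring].
by apply: idealN => //; apply: idealMl.
Qed.

Lemma lenle_join a b L y : is_ideal L -> lenle a (adj L y) -> lenle b (colon L y) ->
  lenle (a + b) L.
Proof.
elim: b L => [|b IHb] L hL ha hb.
  rewrite addn0; apply: lenle_mono ha; apply: adj_sub => //.
  by move: hb; rewrite /= /colon mul1r.
case: hb => v [hv hb]; rewrite addnS; exists (v * y); split.
  by move=> x mx; rewrite mulrA; apply: hv.
apply: IHb; first exact: adj_ideal.
  by apply: lenle_mono ha; apply: adjS; apply: adj_sub_l.
apply: lenle_mono hb; apply: adj_sub; [exact/colon_ideal/adj_ideal| |exact: adj_mem].
by move=> z hz; apply: adj_sub_l.
Qed.

Lemma lenle_pow q a L y : is_ideal L -> lenle a (adj L y) -> lenle (q * a) (adj L (y ^+ q)).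
Proof.
move=> hL ha; elim: q => [|q IHq]; first by rewrite mul0n expr0; apply: adj_mem.
rewrite mulSn addnC; apply: (@lenle_join _ _ _ (y ^+ q)); first exact: adj_ideal.
  by apply: lenle_mono IHq; apply: adjS; apply: adj_sub_l.
apply: lenle_mono ha; apply: adj_sub; first exact/colon_ideal/adj_ideal.
  by move=> z Lz; apply: adj_sub_l; apply: idealMr.
by rewrite /colon -exprS; apply: adj_mem.
Qed.

Definition fpow q := [seq x ^+ q | x <- xs].

Lemma lenle_fpow q : lenle (q ^ size xs) (idgen (fpow q)).
Proof.
suff h s r : perm_eq (s ++ r) xs ->
    lenle (q ^ size s) (idgen ([seq x ^+ q | x <- s] ++ r)).
  by have := h xs [::]; rewrite !cats0; apply.
elim: s r => [|x s IHs] r hp /=.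
  exists 1; split=> [x|]; last exact/adj_mem/idgen_ideal.
  by rewrite mulr1; apply: idgen_subset => b; rewrite (perm_mem hp).
have hp' : perm_eq (s ++ x :: r) xs.
  by apply: perm_trans hp; rewrite -cat1s perm_catCA.
rewrite expnS; set t := _ ++ _.
have : lenle (q ^ size s) (adj (idgen t) x).
  apply: lenle_mono (IHs _ hp'); apply: idgen_sub; first exact/adj_ideal/idgen_ideal.
  move=> b; rewrite mem_cat inE orbCA => /orP [/eqP ->|ht]; first exact/adj_mem/idgen_ideal.
  by apply: adj_sub_l; apply: idgen_mem; rewrite mem_cat.
move=> /(lenle_pow q (idgen_ideal t)); apply: lenle_mono; apply: adj_sub.
- exact: idgen_ideal.
- by apply: idgen_subset => b; rewrite inE => ->; rewrite orbT.
- by apply: idgen_mem; rewrite mem_head.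
Qed.

(** If z y^j lies in L + (y^(j+1)) with j < q, then z y^(q-1) lies in L. So each of the q layers cut
    out by powers of y has length at least that of A/(L : y^(q-1)). *)
Lemma lenle_peel q L y l n : is_ideal L -> (0 < q)%N -> L (y ^+ q) -> lenle n L ->
  (forall k, lenle k (colon L (y ^+ q.-1)) -> (l <= k)%N) -> (q * l <= n)%N.
Proof.
move=> hL q0 Lyq hn hl.
suff h j : (j <= q)%N -> forall n, lenle n (adj L (y ^+ j)) -> (j * l <= n)%N.
  by apply: (h q) => //; apply: lenle_mono hn; apply: adj_sub_l.
elim: j => [|j IHj] ltjq {hn}{}n; first by rewrite mul0n.
move=> /(@lenle_split _ _ (y ^+ j) (adj_ideal _ hL)) [a [b [leab ha hb]]].
apply: leq_trans leab; rewrite mulSn addnC; apply: leq_add.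
  apply: IHj; first exact: ltnW.
  apply: lenle_mono ha; apply: adj_sub; [exact: adj_ideal| |exact: adj_mem].
  apply: adj_sub; [exact: adj_ideal|exact: adj_sub_l|].
  by rewrite exprS; apply: idealMl; [exact: adj_ideal|exact: adj_mem].
apply: hl; apply: lenle_mono hb => z [i [_ [Li [r ->] e]]]; rewrite /colon.
have -> : z * y ^+ q.-1 = z * y ^+ j * y ^+ (q.-1 - j).
  by rewrite -mulrA -exprD subnKC // -ltnS prednK.
rewrite e mulrDl -mulrA -exprD; apply: idealD => //; first exact: idealMr.
have -> : (j.+1 + (q.-1 - j) = q)%N by lia.
exact: idealMl.
Qed.

(** Passing from L to L : x^(q-1) for each parameter costs a factor q; the product outside L keeps
    the last colon proper, hence of colength at least 1. *)
Lemma lenle_ge q s L n : is_ideal L -> (0 < q)%N -> (forall x, x \in s -> L (x ^+ q)) ->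
  ~ L (\prod_(x <- s) x ^+ q.-1) -> lenle n L -> (q ^ size s <= n)%N.
Proof.
elim: s L n => [|x s IHs] L n hL q0 hx hL1 hn.
  by case: n hn => // hn; case: hL1; rewrite big_nil.
rewrite /= expnS; apply: (lenle_peel (y := x) hL q0 _ hn); first exact/hx/mem_head.
move=> k; apply: IHs => //; first exact: colon_ideal.
  by move=> y ys; apply: colon_sub => //; apply: hx; rewrite inE ys orbT.
by rewrite /colon mulrC; rewrite big_cons in hL1.
Qed.

Definition primary L := is_ideal L /\ exists N, mpow xs N `<=` L.

Lemma primary_ideal L : primary L -> is_ideal L. Proof. by case. Qed.
Lemma primaryS L L' : is_ideal L' -> L `<=` L' -> primary L -> primary L'.
Proof. by move=> hL' LL' [_ [N h]]; split=> //; exists N; apply: subset_trans LL'. Qed.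
Lemma primary_cap L L' : primary L -> primary L' -> primary (L `&` L').
Proof.
move=> [hL [N hN]] [hL' [N' hN']]; split; first exact: setI_ideal.
exists (N + N')%N => z hz; split; [apply: hN|apply: hN'].
  by move: hz; apply: mpow_le; apply: leq_addr.
by move: hz; apply: mpow_le; apply: leq_addl.
Qed.
Lemma primary_colon L y : primary L -> primary (colon L y).
Proof.
move=> hL; have iL := primary_ideal hL.
by apply: primaryS hL; [exact: colon_ideal|exact: colon_sub].
Qed.
Lemma primary_fpow q : primary (idgen (fpow q)).
Proof. by split; [exact: idgen_ideal|exact: mpow_sub_powers]. Qed.

Lemma fpow_sub L : primary L -> exists N, forall n, (N <= n)%N -> idgen (fpow n) `<=` L.
Proof.
move=> [hL [N hN]]; exists N => n leNn; apply: idgen_sub => // _ /mapP [x xxs ->].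
by apply/hN/(mpow_le leNn)/mpowX.
Qed.

Definition is_len L n := lenle n L /\ forall k, lenle k L -> (n <= k)%N.

Lemma primary_len L : primary L -> exists n, is_len L n.
Proof.
move=> /fpow_sub [N hN].
have [|n hn hmin] := @nat_min (lenle^~ L); last by exists n.
by exists (N ^ size xs)%N; apply: lenle_mono (lenle_fpow N); apply: hN.
Qed.

(* Members of F minimal modulo the n-th power of the maximal ideal give a compatible
   system of elements outside L whose limit lies in every member of F. *)
Lemma linear_compact (F : set (set A)) L : adic_complete xs ->
  (forall I, F I -> primary I) ->
  (forall I J, F I -> F J -> F (I `&` J)) -> (exists I, F I) -> primary L ->
  bigI F `<=` L -> exists2 I, F I & I `<=` L.
Proof.
move=> hc hF hFI [I0 FI0] hL FL.
have paddI n I : is_ideal I -> primary (addI I (mpow xs n)).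
  move=> hI; split; first by apply: addI_ideal => //; apply: mpow_ideal.
  by exists n; apply: addI_r.
have hmin n : exists I, F I /\ forall J, F J -> I `<=` addI J (mpow xs n).
  have [B [hB _]] := primary_len (paddI n _ (@mpow_ideal _ xs n)).
  (* Choose I with the colength of I + m^n maximal; it is bounded by that of m^n. If I were not
     inside J + m^n, intersecting with J would increase it by [lenle_strict]. *)
  have [||k [I [FI [hk hkmin]]] hmax] :=
    @nat_max (fun k => exists I, F I /\ is_len (addI I (mpow xs n)) k) B.
  - have [k hk] := primary_len (paddI n _ (primary_ideal (hF _ FI0))).
    by exists k, I0.
  - move=> k [I [FI [_ hk]]]; apply: hk; apply: lenle_mono hB.
    apply: addI_sub; [|exact/addI_r/primary_ideal/hF..].
    exact/primary_ideal/paddI/primary_ideal/hF.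
  exists I; split=> // J FJ z Iz; apply: contrapT => nJz.
  have FIJ := hFI _ _ FI FJ; have iIJ := primary_ideal (hF _ FIJ).
  have [k1 [hk1 hk1min]] := primary_len (paddI n _ iIJ).
  have := hmax k1; case: k1 hk1 hk1min => [|k1] hk1 hk1min.
    have /= h1 := ideal_full (primary_ideal (paddI n _ iIJ)) hk1 z.
    exfalso; apply: nJz; move: h1; apply: addI_sub.
    - exact/primary_ideal/paddI/primary_ideal/hF.
    - by move=> w [_ Jw]; apply: addI_l => //; apply: mpow_ideal.
    - exact/addI_r/primary_ideal/hF.
  suff : lenle k1 (addI I (mpow xs n)).
    move=> /hkmin lek /(_ (ex_intro _ _ (conj FIJ (conj hk1 hk1min)))).
    by rewrite ltnNge lek.
  apply: (@lenle_strict _ (addI (I `&` J) (mpow xs n)) _ z) hk1.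
  - exact/primary_ideal/paddI.
  - exact/primary_ideal/paddI/primary_ideal/hF.
  - move=> w [i [j [[Ii _] mj ->]]]; by exists i, j.
  - by apply: addI_l => //; apply: mpow_ideal.
  - move=> [i [j [[_ Ji] mj ez]]]; apply: nJz; by exists i, j.
have [G hG] := choice hmin.
have FG n : F (G n) by have [] := hG n.
have GJ n J : F J -> G n `<=` addI J (mpow xs n) by have [_] := hG n; apply.
apply: contrapT => hno.
have [iL [n0 hn0]] := hL.
have [y0 [Gy0 Ly0]] : exists y, G n0 y /\ ~ L y.
  apply: contrapT => h; apply: hno; exists (G n0) => // z Gz.
  by apply: contrapT => Lz; apply: h; exists z.
have step (nz : nat * A) : exists w, G nz.1 nz.2 -> G nz.1.+1 w /\ mpow xs nz.1 (w - nz.2).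
  have [Gz|nGz] := pselect (G nz.1 nz.2); last by exists 0.
  have [i [j [Gi mj e]]] := GJ _ _ (FG nz.1.+1) _ Gz.
  exists i => _; split=> //; have -> : i - nz.2 = - j by rewrite e; ring.
  by apply: idealN => //; apply: mpow_ideal.
have [g hg] := choice step.
pose u := fix u k := if k is k'.+1 then g ((n0 + k')%N, u k') else y0.
have hu k : G (n0 + k)%N (u k).
  elim: k => [|k IHk]; first by rewrite addn0.
  by rewrite addnS; apply: (hg ((n0 + k)%N, u k) IHk).1.
have hu' k : mpow xs (n0 + k)%N (u k.+1 - u k) := (hg ((n0 + k)%N, u k) (hu k)).2.
have [|l hl] := hc (fun n => u (n - n0)%N).
  move=> n; have [len|ltn] := leqP n0 n.
    by have := hu' (n - n0)%N; rewrite subSn // subnKC.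
  have -> : (n.+1 - n0 = n - n0)%N by lia.
  by rewrite subrr; apply: mpow0.
have hlu k : mpow xs (n0 + k)%N (l - u k) by have := hl (n0 + k)%N; rewrite addKn.
apply: Ly0; have -> : y0 = l - (l - u 0%N) by rewrite /=; ring.
apply: idealB => //; last by apply: hn0; have := hlu 0%N; rewrite addn0.
apply: FL => J FJ; have [iJ [N hN]] := hF _ FJ.
have [i [j [Ji mj e]]] := GJ _ _ FJ _ (hu N).
have -> : l = (l - u N) + (i + j) by rewrite -e; ring.
have leN : (N <= n0 + N)%N by apply: leq_addl.
apply: idealD => //; first exact/hN/(mpow_le leN).
by apply: idealD => //; apply/hN/(mpow_le leN).
Qed.

End Length.

(** * Frobenius powers, their colengths and flatness *)

Section FrobeniusPowers.
Variables (A : comNzRingType) (p : nat).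
Hypothesis hp : p \in [pchar A].
Implicit Types (I J K L : set A) (e : nat).

Lemma exprD_frob e (a b : A) : (a + b) ^+ (p ^ e) = a ^+ (p ^ e) + b ^+ (p ^ e).
Proof.
elim: e => [|e IHe]; first by rewrite expn0 !expr1.
by rewrite expnSr !exprM IHe -!(pFrobenius_autE hp) pFrobenius_autD_comm //; apply: mulrC.
Qed.

Lemma frob_gt0 e : (0 < p ^ e)%N.
Proof. by rewrite expn_gt0 prime_gt0 // (pcharf_prime hp). Qed.

Definition frob q L := genI (fun z => exists2 r, L r & z = r ^+ q).

Lemma frob_ideal q L : is_ideal (frob q L). Proof. exact: genI_ideal. Qed.
Lemma frob_mem q L r : L r -> frob q L (r ^+ q).
Proof. by move=> Lr; apply: genI_mem; exists r. Qed.
Lemma frob_sub q L J : is_ideal J -> (forall r, L r -> J (r ^+ q)) -> frob q L `<=` J.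
Proof. by move=> hJ h; apply: genI_sub => // z [r Lr ->]; apply: h. Qed.
Lemma frobS q L L' : L `<=` L' -> frob q L `<=` frob q L'.
Proof. by move=> h; apply: frob_sub; [exact: frob_ideal|move=> r /h; exact: frob_mem]. Qed.

Lemma expq_ideal e J : is_ideal J -> is_ideal (fun z => J (z ^+ (p ^ e))).
Proof.
move=> hJ; split; first by rewrite expr0n -leqn0 leqNgt frob_gt0; apply: ideal0.
split=> [x y Jx Jy|a x Jx]; first by rewrite exprD_frob; apply: idealD.
by rewrite exprMn; apply: idealMl.
Qed.

Lemma frob_adj e L y : is_ideal L ->
  frob (p ^ e) (adj L y) `<=` adj (frob (p ^ e) L) (y ^+ (p ^ e)).
Proof.
move=> hL; have hF := frob_ideal (p ^ e) L.
apply: frob_sub => [|_ [i [_ [Li [r ->] ->]]]]; first exact: adj_ideal.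
rewrite exprD_frob exprMn; exists (i ^+ (p ^ e)), (r ^+ (p ^ e) * y ^+ (p ^ e)).
by split; [exact: frob_mem|exists (r ^+ (p ^ e))|].
Qed.

Lemma frob_idgen e s : frob (p ^ e) (idgen s) = idgen [seq x ^+ (p ^ e) | x <- s].
Proof.
apply/seteqP; split; last first.
  apply: idgen_sub => [|_ /mapP [x xs ->]]; first exact: frob_ideal.
  by apply: frob_mem; apply: idgen_mem.
apply: frob_sub; first exact: idgen_ideal.
apply: (idgen_sub (J := fun z => idgen [seq x ^+ (p ^ e) | x <- s] (z ^+ (p ^ e)))).
  exact/expq_ideal/idgen_ideal.
by move=> b bs; apply: idgen_mem; apply: map_f.
Qed.

Lemma frob_frob e e' L : frob (p ^ e) (frob (p ^ e') L) = frob (p ^ (e' + e)) L.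
Proof.
apply/seteqP; split; last first.
  apply: frob_sub => [|r Lr]; first exact: frob_ideal.
  by rewrite expnD exprM; do 2!apply: frob_mem.
apply: frob_sub; first exact: frob_ideal.
apply: (frob_sub (J := fun z => frob (p ^ (e' + e)) L (z ^+ (p ^ e)))).
  exact/expq_ideal/frob_ideal.
by move=> r Lr; rewrite -exprM -expnD; apply: frob_mem.
Qed.

Lemma frob_colon_sub q L y : is_ideal L -> frob q (colon L y) `<=` colon (frob q L) (y ^+ q).
Proof.
move=> hL; apply: frob_sub; first exact/colon_ideal/frob_ideal.
by move=> r h; rewrite /colon -exprMn; apply: frob_mem.
Qed.

Variable xs : seq A.
Hypothesis hN : noeth A.
Hypothesis hloc : locally_units xs.
Hypothesis hsoc : forall e, ~ idgen (fpow xs (p ^ e)) (\prod_(x <- xs) x ^+ (p ^ e).-1).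

Local Notation d := (size xs).

Lemma primary_frob e L : primary xs L -> primary xs (frob (p ^ e) L).
Proof.
move=> hL; have [N hNs] := fpow_sub hL.
apply: primaryS (primary_fpow xs (N * p ^ e)); first exact: frob_ideal.
apply: idgen_sub; first exact: frob_ideal.
move=> _ /mapP [x xxs ->]; rewrite exprM; apply: frob_mem; apply: (hNs N) => //.
by apply: idgen_mem; apply: map_f.
Qed.

Lemma lenle_frob e n L : is_ideal L -> lenle xs n L ->
  lenle xs ((p ^ e) ^ d * n) (frob (p ^ e) L).
Proof.
elim: n L => [|n IHn] L hL.
  by rewrite muln0 => L1; have := @frob_mem (p ^ e)%N L 1 L1; rewrite expr1n.
case=> y [hy hn]; rewrite mulnS addnC.
apply: (@lenle_join _ _ _ _ _ (y ^+ (p ^ e))); first exact: frob_ideal.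
  by apply: lenle_mono (IHn _ (adj_ideal y hL) hn); apply: frob_adj.
apply: lenle_mono (lenle_fpow xs (p ^ e)).
apply: idgen_sub; first exact/colon_ideal/frob_ideal.
move=> _ /mapP [x xxs ->]; rewrite /colon -exprMn; apply: frob_mem; apply: hy.
exact: idgen_mem.
Qed.

Lemma lenle_fpow_ge e n : lenle xs n (idgen (fpow xs (p ^ e))) -> ((p ^ e) ^ d <= n)%N.
Proof.
apply: lenle_ge => //; [exact: idgen_ideal|exact: frob_gt0|].
by move=> x xxs; apply: idgen_mem; apply: map_f.
Qed.

(** With len for colength and q = p^e, the bound holds for m^[p^N], whose Frobenius powers have the
    same form. It passes to K + (b) because q^d len(K) <= len(K^[q]) <= len((K + (b))^[q]) + q^d
    len(K : b), while len(K) >= len(K + (b)) + len(K : b). *)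
Lemma lenle_frob_ge e L n k : primary xs L -> is_len xs L n ->
  lenle xs k (frob (p ^ e) L) -> ((p ^ e) ^ d * n <= k)%N.
Proof.
move=> hL; have [N hNs] := fpow_sub hL.
have p1 : (1 < p)%N by rewrite prime_gt1 // (pcharf_prime hp).
have {hNs} sub := hNs (p ^ N)%N (ltnW (ltn_expl N p1)).
have [s hs] := hN (primary_ideal hL).
suff h s' : (forall b, b \in s' -> L b) -> forall n k,
    is_len xs (addI (idgen (fpow xs (p ^ N))) (idgen s')) n ->
    lenle xs k (frob (p ^ e) (addI (idgen (fpow xs (p ^ N))) (idgen s'))) ->
    ((p ^ e) ^ d * n <= k)%N.
  have eL : addI (idgen (fpow xs (p ^ N))) (idgen s) = L.
    apply/seteqP; split; last by move=> z /hs; apply/addI_r/idgen_ideal.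
    by apply: addI_sub => //; [exact: (primary_ideal hL)|move=> z /hs].
  by have := h s (fun b bs => proj2 (hs b) (idgen_mem bs)) n k; rewrite eL.
elim: s' => [|b s' IHs] hs' {}n {}k.
  have -> : addI (idgen (fpow xs (p ^ N))) (idgen [::]) = idgen (fpow xs (p ^ N)).
    apply/seteqP; split; last exact/addI_l/idgen_ideal.
    by apply: addI_sub => //; [exact: idgen_ideal|move=> z ->; apply: (ideal0 (idgen_ideal _))].
  move=> [_ /(_ _ (lenle_fpow xs (p ^ N))) len].
  have -> : frob (p ^ e) (idgen (fpow xs (p ^ N))) = idgen (fpow xs (p ^ (N + e))).
    rewrite frob_idgen /fpow -map_comp; congr idgen; apply: eq_map => x /=.
    by rewrite -exprM expnD.
  move=> /lenle_fpow_ge; apply: leq_trans.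
  by rewrite expnD expnMn mulnC leq_mul2r len orbT.
have {}IHs := IHs (fun c cs => hs' c (mem_behead (s := b :: s') cs)).
set K := addI (idgen (fpow xs (p ^ N))) (idgen s') in IHs *.
have hK : primary xs K.
  apply: primaryS (primary_fpow xs (p ^ N)); first by apply: addI_ideal; apply: idgen_ideal.
  exact/addI_l/idgen_ideal.
have iK := primary_ideal hK.
have -> : addI (idgen (fpow xs (p ^ N))) (idgen (b :: s')) = adj K b.
  apply/seteqP; split.
    apply: addI_sub; first exact: adj_ideal.
      by move=> z hz; apply: adj_sub_l; apply: addI_l hz; apply: idgen_ideal.
    apply: idgen_sub; first exact: adj_ideal.
    move=> c; rewrite inE => /orP [/eqP ->|cs]; first exact: adj_mem.
    by apply: adj_sub_l; apply: addI_r; [exact: idgen_ideal|exact: idgen_mem].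
  have hi : is_ideal (addI (idgen (fpow xs (p ^ N))) (idgen (b :: s'))).
    by apply: addI_ideal; apply: idgen_ideal.
  apply: adj_sub => //.
    apply: addI_sub => //; first exact/addI_l/idgen_ideal.
    apply: subset_trans (addI_r (idgen_ideal _)); apply: idgen_subset => c cs.
    by rewrite inE cs orbT.
  by apply: addI_r; [exact: idgen_ideal|apply/idgen_mem/mem_head].
move=> [_ hn] hk.
have [c [hc hcmin]] := primary_len (primary_colon b hK).
have [a ha] := primary_len hK.
have [a1 [c1 [le1 /hn len /hcmin lec]]] := lenle_split hloc b iK ha.1.
have /(IHs _ _ ha) : lenle xs (k + (p ^ e) ^ d * c) (frob (p ^ e) K).
  apply: (@lenle_join _ _ _ _ _ (b ^+ (p ^ e))); first exact: frob_ideal.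
    by apply: lenle_mono hk; apply: frob_adj.
  apply: lenle_mono (lenle_frob e (colon_ideal b iK) hc).
  exact: frob_colon_sub.
move=> h; rewrite -(leq_add2r ((p ^ e) ^ d * c)); apply: leq_trans h.
by rewrite -mulnDr leq_mul2l (leq_trans (leq_add len lec) le1) orbT.
Qed.

(* A strict inclusion would make the length of L^[q], split along y^q, smaller
   than q^d times that of L. *)
Theorem frob_colon e L y : primary xs L ->
  colon (frob (p ^ e) L) (y ^+ (p ^ e)) `<=` frob (p ^ e) (colon L y).
Proof.
move=> hL u hu; apply: contrapT => nu.
have iL := primary_ideal hL.
have [n hn] := primary_len hL.
have [a [b [leab ha hb]]] := lenle_split hloc y iL hn.1.
have icF := colon_ideal (y ^+ (p ^ e)) (frob_ideal (p ^ e) L).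
have := lenle_frob e (colon_ideal y iL) hb.
case E : ((p ^ e) ^ d * b)%N => [|k] hk.
  by apply: nu; apply: ideal_full; [exact: frob_ideal|exact: hk].
have hk' : lenle xs k (colon (frob (p ^ e) L) (y ^+ (p ^ e))).
  apply: lenle_strict hk => //; [exact: frob_ideal|exact: frob_colon_sub|exact: hu|exact: nu].
have : lenle xs ((p ^ e) ^ d * a + k) (frob (p ^ e) L).
  apply: lenle_join hk'; first exact: frob_ideal.
  by apply: lenle_mono (lenle_frob e (adj_ideal y iL) ha); apply: frob_adj.
move=> /(lenle_frob_ge hL hn); rewrite leqNgt => /negP; apply.
have : ((p ^ e) ^ d * (a + b) <= (p ^ e) ^ d * n)%N by rewrite leq_mul2l leab orbT.
by apply: leq_trans; rewrite mulnDr E -addnS.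
Qed.

Lemma frob_cap_seq e L' K s : primary xs L' -> primary xs K -> K `<=` L' ->
  frob (p ^ e) (addI K (idgen s)) `&` frob (p ^ e) L' `<=`
  frob (p ^ e) (addI K (idgen s) `&` L').
Proof.
move=> hL' hK KL'; have [iL' iK] := (primary_ideal hL', primary_ideal hK).
elim: s => [|a s IHs] z [hz hz'].
  move: hz; apply: frobS => w [k [_ [Kk -> ->]]]; rewrite addr0.
  split; last exact: KL'.
  by exists k, 0; rewrite addr0.
have iKs l : is_ideal (addI K (idgen l)) by apply: addI_ideal => //; apply: idgen_ideal.
have sub_s : addI K (idgen s) `<=` addI K (idgen (a :: s)).
  apply: addI_sub => //; first exact/addI_l/idgen_ideal.
  apply: subset_trans (addI_r iK); apply: idgen_subset => c cs; by rewrite inE cs orbT.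
pose N := addI L' (idgen s).
have iN : is_ideal N by apply: addI_ideal => //; apply: idgen_ideal.
have hN' : primary xs N by apply: primaryS hL' => //; apply/addI_l/idgen_ideal.
have [u [_ [Fu [c ->] ez]]] : adj (frob (p ^ e) (addI K (idgen s))) (a ^+ (p ^ e)) z.
  apply: frob_adj => //; move: hz; apply: frobS.
  apply: addI_sub; first exact: adj_ideal.
    by move=> w Kw; apply: adj_sub_l; apply: addI_l Kw; apply: idgen_ideal.
  apply: idgen_sub; first exact: adj_ideal.
  move=> b; rewrite inE => /orP [/eqP ->|bs]; first exact: adj_mem.
  by apply: adj_sub_l; apply: addI_r => //; exact: idgen_mem.
have FNc : frob (p ^ e) (colon N a) c.
  apply: frob_colon => //; rewrite /colon.
  have -> : c * a ^+ (p ^ e) = z - u by rewrite ez; ring.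
  apply: (idealB (frob_ideal _ _)).
    by move: hz'; apply: frobS; apply/addI_l/idgen_ideal.
  move: Fu; apply: frobS; apply: addI_sub => //.
    by move=> w /KL'; apply/addI_l/idgen_ideal.
  exact: addI_r.
pose M := addI K (idgen (a :: s)) `&` L'.
have : addI (frob (p ^ e) M) (frob (p ^ e) (addI K (idgen s))) (c * a ^+ (p ^ e)).
  suff : frob (p ^ e) (colon N a) `<=`
    colon (addI (frob (p ^ e) M) (frob (p ^ e) (addI K (idgen s)))) (a ^+ (p ^ e)) by apply.
  apply: frob_sub.
    by apply/colon_ideal/addI_ideal; apply: frob_ideal.
  move=> b [l [y [L'l sy eb]]]; rewrite /colon -exprMn eb exprD_frob.
  exists (l ^+ (p ^ e)), (y ^+ (p ^ e)); split=> //; apply: frob_mem.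
    split=> //; have -> : l = b * a - y by rewrite eb; ring.
    apply: idealB => //.
      by apply: idealMl => //; apply: addI_r => //; apply/idgen_mem/mem_head.
    by apply: sub_s; apply: addI_r.
  exact: addI_r.
case=> w [u' [Fw Fu' ew]].
have -> : z = w + (u + u') by rewrite ez ew; ring.
apply: (idealD (frob_ideal _ _)); first exact: Fw.
have : frob (p ^ e) (addI K (idgen s) `&` L') (u + u').
  apply: IHs; split; first exact: (idealD (frob_ideal _ _)).
  have -> : u + u' = z - w by rewrite ez ew; ring.
  apply: (idealB (frob_ideal _ _)) => //.
  by move: Fw; apply: frobS => ? [].
by apply: frobS => v [/sub_s ? ?]; split.
Qed.

Lemma frob_cap e L L' : primary xs L -> primary xs L' ->
  frob (p ^ e) L `&` frob (p ^ e) L' `<=` frob (p ^ e) (L `&` L').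
Proof.
move=> hL hL'; have [s hs] := hN (primary_ideal hL).
have hK := primary_cap hL hL'.
have eL : addI (L `&` L') (idgen s) = L.
  apply/seteqP; split.
    by apply: addI_sub; [exact: (primary_ideal hL)|move=> ? []|move=> z /hs].
  by move=> z /hs; apply/addI_r/(primary_ideal hK).
by have := @frob_cap_seq e L' (L `&` L') s hL' hK (@subIsetr _ _ _); rewrite eL.
Qed.

End FrobeniusPowers.

(** * Hartshorne-Speiser-Lyubeznik stability *)

(** This is a (1 + q + ... + q^(n-1)). For q = p^l it is the value of n repetitions of a word of l
    base-p digits with value a. *)
Fixpoint periodic_num q a n := if n is n'.+1 then (periodic_num q a n' + q ^ n' * a)%N else 0%N.

Lemma periodic_numS q a n : periodic_num q a n.+1 = (q * periodic_num q a n + a)%N.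
Proof.
elim: n => [|n IHn]; first by rewrite /= muln0 expn0 mul1n.
by rewrite [LHS]/= -/(periodic_num q a n.+1) {1}IHn /= expnS mulnDr mulnA addnAC.
Qed.

Section Stability.
Variables (A : comNzRingType) (p : nat).
Hypothesis hp : p \in [pchar A].
Implicit Types (I J K L : set A).
Variable xs : seq A.
Hypothesis hN : noeth A.
Hypothesis hloc : locally_units xs.
Hypothesis hsoc : forall e, ~ idgen (fpow xs (p ^ e)) (\prod_(x <- xs) x ^+ (p ^ e).-1).
Hypothesis hc : adic_complete xs.
Variable f : A.

Lemma primaryT : primary xs (@setT A). Proof. by split=> //; exists 0%N. Qed.

Lemma frobT e : frob (p ^ e) (@setT A) = setT.
Proof.
apply/seteqP; split=> // z _; apply: (ideal_full (frob_ideal _ _)).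
by rewrite -(expr1n A (p ^ e)); apply: frob_mem.
Qed.

Section HartshorneSpeiserLyubeznik.
Variables (l a : nat).
Hypothesis l0 : (0 < l)%N.

Local Notation q := (p ^ l)%N.
Local Notation an := (periodic_num q a).

Let q1 : (1 < q)%N.
Proof. by rewrite -(exp1n l) ltn_exp2r // prime_gt1 // (pcharf_prime hp). Qed.

Let F n : set (set A) := [set L | primary xs L /\ frob (p ^ (l * n)) L (f ^+ an n)].
Let Psi L := colon (frob q L) (f ^+ a).
Let I n := bigI (F n).

Let primary_Psi L : primary xs L -> primary xs (Psi L).
Proof. by move=> hL; apply/primary_colon/primary_frob. Qed.

Let F_up n L L' : F n L -> primary xs L' -> L `<=` L' -> F n L'.
Proof. by move=> [_ FL] hL' LL'; split=> //; apply: frobS FL. Qed.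

Let F_asc n : F n `<=` F n.+1.
Proof.
move=> L [hL FL]; split=> //; rewrite periodic_numS exprD (mulnC q) exprM.
apply: (idealMr _ (frob_ideal _ _)).
by rewrite mulnSr -(frob_frob hp); apply: frob_mem.
Qed.

(* Psi plays the role of the inverse image under the Frobenius twisted by f^a. *)
Let F_Psi n L : primary xs L -> F n.+1 L <-> F n (Psi L).
Proof.
move=> hL; have e : frob (p ^ (l * n.+1)) L (f ^+ an n.+1) <->
    frob (p ^ (l * n)) (Psi L) (f ^+ an n).
  rewrite mulnS -(frob_frob hp) /= exprD (mulnC _ a) exprM -expnM.
  split=> [h|/frob_colon_sub h]; last by apply: h; apply: frob_ideal.
  have hFL : primary xs (frob q L) by exact: primary_frob.
  exact: (frob_colon hp hN hloc hsoc (y := f ^+ a) hFL h).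
split=> [[_ /e h]|[_ /e h]]; split=> //; exact: primary_Psi.
Qed.

Let F_I n L : primary xs L -> I n `<=` L -> F n L.
Proof.
move=> hL IL; have [|||K FK KL] := linear_compact hloc hc (F := F n) _ _ _ hL IL.
- by move=> K [].
- move=> K K' [hK FK] [hK' FK']; split; first exact: primary_cap.
  exact: (frob_cap hp hN hloc hsoc).
- by exists setT; split; [exact: primaryT|rewrite frobT].
- exact: F_up FK _ KL.
Qed.

Let I_ideal n : is_ideal (I n).
Proof. by apply: bigI_ideal => L [[]]. Qed.

Let I_sub n L : F n L -> I n `<=` L.
Proof. by move=> FL z; apply. Qed.

Let I_desc n : I n.+1 `<=` I n.
Proof. by move=> z Iz L /F_asc; apply: Iz. Qed.

(** Flatness puts (Psi L : x^q) inside Psi (L : x). So [I n] lies in Psi (L : x), which makes L : x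
    a member of [F n.+1]. *)
Let I_step n L x : primary xs L -> (forall y, I n y -> Psi L (x ^+ q * y)) ->
  forall y, I n.+1 y -> L (x * y).
Proof.
move=> hL h y; have hLx := primary_colon x hL.
suff FL : F n.+1 (colon L x) by move=> /(I_sub FL); rewrite /colon mulrC.
apply/F_Psi => //; apply: F_I; first exact: primary_Psi.
move=> z /h; rewrite /Psi /colon -mulrA mulrC => hz.
by apply: (frob_colon hp hN hloc hsoc hL).
Qed.

Let b n := colonI (I n.+1) (I n).

Let b_ideal n : is_ideal (b n). Proof. exact: colonI_ideal. Qed.

Let b_step n x : b n (x ^+ q) -> b n.+1 x.
Proof.
move=> bx y Iy L FL; have [hL _] := FL.
have /I_sub FPsi := proj1 (F_Psi n.+1 hL) FL.
by apply: (@I_step n) => // z /bx /FPsi.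
Qed.

Let b_asc n : b n `<=` b n.+1.
Proof.
move=> x bx; apply: b_step; rewrite -(subnK (ltnW q1)) addn1 exprS.
exact: (idealMr _ (b_ideal n) bx).
Qed.

Lemma hsl_stable : exists n0, forall n L, primary xs L ->
  frob (p ^ (l * n)) L (f ^+ an n) -> frob (p ^ (l * n0)) L (f ^+ an n0).
Proof.
have [N hNb] := acc hN b_ideal b_asc; exists N.
have bN n : (N <= n)%N -> b n `<=` b N by move=> /hNb.
have radb x : b N (x ^+ q) -> b N x by move=> /b_step; apply: bN.
have radb2 x : b N (x * x) -> b N x.
  move=> h; apply: radb; rewrite -(subnK q1) exprD expr2.
  exact: (idealMl _ (b_ideal N) h).
(* The factor y moves z into I_(N+1). The factor x reaches [Psi L] as x^q, a multiple of x^2 because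
   q >= 2, so the induction hypothesis applies to the pair x, x. *)
have b2 k x y z : b N x -> b N y -> I N z -> I (N + k)%N (x * y * z).
  move=> bx; elim: k y z => [|k IHk] y z bY Iz; first by rewrite addn0;
    exact: (idealMl _ (I_ideal N) Iz).
  rewrite addnS => L FL; have [hL _] := FL.
  have /I_sub FPsi := proj1 (F_Psi (N + k)%N hL) FL.
  rewrite -mulrA; apply: (@I_step N) => //; last exact: bY.
  move=> w Iw; apply: FPsi; rewrite -(subnK q1) exprD expr2 -mulrA.
  by apply: (idealMl _ (I_ideal _)); apply: IHk.
have [b1|b1] := pselect (b N 1).
  have IN k : I N `<=` I (N + k)%N by move=> z Iz; rewrite -[z]mul1r -[1]mulr1; apply: b2.
  move=> n L hL FL; suff: F N L by case.
  have [leNn|/ltnW lenN] := leqP N n; last exact: (asc_le F_asc lenN).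
  apply: F_I => //; apply: subset_trans (IN (n - N)%N) _; rewrite subnKC //.
  exact: I_sub.
exfalso.
(* [Q] is an associated prime of [b N], obtained as a maximal colon (b N : s). Since [b N] is
   radical, s lies outside [Q]. *)
have [||Q [s bs eQ] [_ Qmax]] := @max_ideal _ hN
  [set K | exists2 s, ~ b N s & K = colon (b N) s] (colon (b N) 1).
- by exists 1.
- by move=> _ [s _ ->]; apply: colon_ideal.
have hQ : is_prime_ideal Q.
  split; first by rewrite eQ; apply: colon_ideal.
  split; first by rewrite eQ /colon mul1r.
  move=> x y Qxy; have [Qx|nQx] := pselect (Q x); [by left|right].
  apply: (Qmax (colon (b N) (x * s))).
  - by exists (x * s) => //; rewrite eQ in nQx.
  - move=> z; rewrite eQ /colon => bz; have -> : z * (x * s) = x * (z * s) by ring.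
    exact: (idealMl _ (b_ideal N) bz).
  - by move: Qxy; rewrite eQ /colon (mulrC x) mulrA.
have Qs : ~ Q s by rewrite eQ => /radb2.
(* For u, v in [Q] both u s and v s are in [b N], so s^2 Q^2 I_N lies in every I_(N+n): hence the
   exponent 2. The resulting t outside [Q] multiplies some I_(N+n) into the next, so t is in [b N],
   which is inside [Q]. *)
have [|||n /(_ n (leqnn n)) [t Qt ht]] := @stable_at_prime _ hN Q 2 (s * s) (I N)
  (fun n => I (N + n)%N) hQ (prime_notM hQ Qs Qs) (I_ideal N) (fun n => I_ideal _).
- by move=> n; rewrite addnS; apply: I_desc.
- by move=> n; apply: (desc_le I_desc); apply: leq_addr.
- move=> n [|u [|v []]] // z _ hus Iz; rewrite big_cons big_seq1.
  have -> : s * s * (u * v * z) = (u * s) * (v * s) * z by ring.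
  by apply: b2 => //; [have := hus u|have := hus v]; rewrite eQ; apply;
    rewrite !inE eqxx ?orbT.
apply: Qt; rewrite eQ; apply: (idealMr _ (b_ideal N)); apply: (bN (N + n)%N);
  first exact: leq_addr.
by move=> z Iz; rewrite -addnS; apply: ht.
Qed.

End HartshorneSpeiserLyubeznik.

(** The families of ideals meeting all bounds [E i] shrink with i, so their intersections ascend and
    stabilize. Linear compactness then puts a member of [F N.+1] inside [J N], which forces the
    smaller bounds on [J N]. *)
Lemma threshold_wf (E : nat -> nat -> nat) (J : nat -> set A) :
  (forall i, primary xs (J i)) ->
  (forall i n k, frob (p ^ n) (J i) (f ^+ k) <-> (E i n < k)%N) ->
  (forall i n, (E i.+1 n <= E i n)%N) ->
  ~ forall i, exists n, (E i.+1 n < E i n)%N.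
Proof.
move=> hJ hE Ele hlt.
pose F i : set (set A) := [set L | primary xs L /\ forall n, frob (p ^ n) L (f ^+ (E i n).+1)].
have FS i : F i.+1 `<=` F i.
  move=> L [hL FL]; split=> // n; have := FL n.
  have -> : (E i n).+1 = ((E i.+1 n).+1 + (E i n - E i.+1 n))%N.
    by rewrite addSn subnKC.
  by rewrite exprD; apply: (idealMr _ (frob_ideal _ _)).
have [||N hN'] := @acc _ hN (fun i => bigI (F i)).
- by move=> i; apply: bigI_ideal => L [[]].
- by move=> i z hz L /FS; apply: hz.
have [||||L [_ FL] LJ] := linear_compact hloc hc (F := F N.+1) _ _ _ (hJ N) _.
- by move=> K [].
- move=> K K' [hK FK] [hK' FK']; split=> [|n]; first exact: primary_cap.
  exact: (frob_cap hp hN hloc hsoc hK hK' (conj (FK n) (FK' n))).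
- by exists setT; split=> [|n]; [exact: primaryT|rewrite frobT].
- move=> z /(hN' N.+1 (leqnSn N)); apply; split=> // n.
  by apply/hE.
have [n ltn] := hlt N.
have : frob (p ^ n) (J N) (f ^+ (E N.+1 n).+1) by apply: frobS (FL n).
by move=> /hE; rewrite ltnS leqNgt ltn.
Qed.

End Stability.

(** * Well-ordered sets of tails *)

Lemma dependent_choice_nat (T : Type) (X : set T) (R : T -> T -> Prop) (x0 : T) :
  X x0 -> (forall x, X x -> exists y, X y /\ R x y) ->
  exists u : nat -> T, (forall i, X (u i)) /\ forall i, R (u i) (u i.+1).
Proof.
move=> Xx0 h; pose S := {x | X x}.
have h' (x : S) : exists y : S, R (sval x) (sval y).
  by have [y [Xy Rxy]] := h _ (svalP x); exists (exist _ y Xy).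
have [g hg] := choice h'.
exists (fun i => sval (iter i g (exist _ x0 Xx0))); split=> i; first exact: svalP.
exact: hg.
Qed.

Section Words.
Implicit Types (a b c m y z : nat -> nat).

Definition agree n a b := forall i, (i < n)%N -> a i = b i.
Definition slt a b := exists2 n, agree n a b & (a n < b n)%N.
Definition shift k a i := a (k + i)%N.
(* z is a limit point of the shifts of y. *)
Definition omega y z := forall n N, exists2 k, (N <= k)%N & agree n (shift k y) z.
Definition lex_wf (X : set (nat -> nat)) :=
  ~ exists u : nat -> nat -> nat, (forall i, X (u i)) /\ forall i, slt (u i.+1) (u i).

Lemma agree_le n k a b : (n <= k)%N -> agree k a b -> agree n a b.
Proof. by move=> lenk h i ltin; apply: h; apply: leq_trans lenk. Qed.
Lemma agree_sym n a b : agree n a b -> agree n b a.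
Proof. by move=> h i /h. Qed.
Lemma agree_trans n a b c : agree n a b -> agree n b c -> agree n a c.
Proof. by move=> h h' i ltin; rewrite h ?h'. Qed.

Lemma lex_total a b : ~ slt a b -> ~ slt b a -> a = b.
Proof.
move=> nab nba; apply: contrapT => neq.
have [|n hn hmin] := @nat_min (fun n => a n <> b n).
  by apply: contrapT => h; apply: neq; apply: funext => n; apply: contrapT => hn; apply: h;
    exists n.
have ag : agree n a b by move=> i ltin; apply: contrapT => /hmin; rewrite leqNgt ltin.
have [lt|lt|//] := ltngtP (a n) (b n); [apply: nab|apply: nba]; exists n => //.
exact: agree_sym.
Qed.

Lemma lex_wf_min (X P : set (nat -> nat)) : lex_wf X -> P `<=` X -> (exists z, P z) ->
  exists2 z, P z & forall z', P z' -> ~ slt z' z.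
Proof.
move=> hX PX [z0 Pz0]; apply: contrapT => hno; apply: hX.
have [|u [Pu hu]] := @dependent_choice_nat _ P (fun x y => slt y x) z0 Pz0.
  move=> x Px; apply: contrapT => h; apply: hno; exists x => // z' Pz' lt.
  by apply: h; exists z'.
by exists u; split=> // i; apply: PX.
Qed.

(** Points of [X] approaching [m] from above could be chosen so that each agrees with [m] beyond the
    place where the previous one exceeds it, an infinite descent. *)
Lemma lex_wf_isolated (X : set (nat -> nat)) m : lex_wf X ->
  exists n, forall z, X z -> agree n z m -> ~ slt m z.
Proof.
move=> hX; apply: contrapT => hno; apply: hX.
have h n : exists z, [/\ X z, agree n z m & slt m z].
  apply: contrapT => hn; apply: hno; exists n => z Xz ag lt.
  by apply: hn; exists z.
have [z0 [Xz0 _ lt0]] := h 0%N.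
have [//||u [Xu hu]] := @dependent_choice_nat _ [set z | X z /\ slt m z]
  (fun x y => slt y x) z0.
  move=> z [Xz [n ag lt]]; have [z' [Xz' ag' lt']] := h n.+1.
  exists z'; split=> //; exists n; last by rewrite ag'.
  by apply: agree_trans ag; apply: agree_le ag'.
by exists u; split=> // i; case: (Xu i).
Qed.

Lemma omega_shift y z k : omega y z -> omega y (shift k z).
Proof.
move=> h n N; have [j leNj ag] := h (k + n)%N N.
exists (j + k)%N; first exact: leq_trans (leq_addr _ _).
by move=> i ltin; rewrite /shift -addnA; apply: ag; rewrite ltn_add2l.
Qed.

Lemma omega_trans x y z : omega x y -> omega y z -> omega x z.
Proof.
move=> hxy hyz n N; have [k _ ag] := hyz n 0%N.
have [j leNj ag'] := omega_shift k hxy n N.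
by exists j => //; apply: agree_trans ag.
Qed.

Lemma omega_bound p y z : (forall i, y i < p)%N -> omega y z -> forall i, (z i < p)%N.
Proof. by move=> hy h i; have [k _ /(_ i (ltnSn i)) <-] := h i.+1 0%N; apply: hy. Qed.

(** Greedy choice: each digit is the largest one extending the prefix to a word that recurs
    infinitely often in [y]. Some digit does, by pigeonhole. *)
Lemma omega_max p y : (forall i, y i < p)%N ->
  exists2 z, omega y z & forall z', omega y z' -> ~ slt z z'.
Proof.
move=> hy.
pose G n a := forall N, exists2 k, (N <= k)%N & agree n (shift k y) a.
pose upd n a v : nat -> nat := fun i => if i == n then v else a i.
have upd_agree n a v : agree n (upd n a v) a.
  by move=> i ltin; rewrite /upd ltn_eqF.
have G_agree n a a' : agree n a a' -> G n a -> G n a'.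
  by move=> h hG N; have [k leNk ag] := hG N; exists k => //; apply: agree_trans h.
have step (na : nat * (nat -> nat)) : exists v, G na.1 na.2 ->
    G na.1.+1 (upd na.1 na.2 v) /\ forall v', G na.1.+1 (upd na.1 na.2 v') -> (v' <= v)%N.
  case: na => n a /=; have [hG|hG] := pselect (G n a); last by exists 0%N.
  have [||v Gv vmax] := @nat_max (fun v => G n.+1 (upd n a v)) p; last by exists v.
    apply: contrapT => hno.
    have hv v : exists N, forall k, (N <= k)%N -> ~ agree n.+1 (shift k y) (upd n a v).
      apply: contrapT => hv; apply: hno; exists v => N; apply: contrapT => hN.
      by apply: hv; exists N => k leNk ag; apply: hN; exists k.
    have [g hg] := choice hv.
    have [k lek ag] := hG (\max_(v < p) g v).
    have ltk : (shift k y n < p)%N by apply: hy.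
    apply: (hg (shift k y n) k).
      by apply: leq_trans lek; apply: (leq_bigmax (Ordinal ltk)).
    move=> i; rewrite ltnS leq_eqVlt /upd => /orP [/eqP ->|ltin]; first by rewrite eqxx.
    by rewrite ltn_eqF // ag.
  move=> v /(_ 0%N) [k _ /(_ n (ltnSn n))]; rewrite /upd eqxx => <-.
  exact/ltnW/hy.
have [g hg] := choice step.
pose a := fix a n := if n is n'.+1 then upd n' (a n') (g (n', a n')) else fun=> 0%N.
have Ga n : G n (a n).
  by elim: n => [|n IHn]; [move=> N; exists N|apply: (hg (n, a n) IHn).1].
pose z i := g (i, a i).
have za n : agree n z (a n).
  elim: n => [|n IHn] // i; rewrite ltnS leq_eqVlt /= /upd => /orP [/eqP ->|ltin].
    by rewrite eqxx.
  by rewrite ltn_eqF // IHn.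
exists z => [n|z' hz' [n ag lt]]; first exact: (G_agree _ _ _ (agree_sym (za n)) (Ga n)).
have := (hg (n, a n) (Ga n)).2 (z' n); rewrite /= leqNgt lt => /(_ _) h.
suff : false by []; apply: h; apply: G_agree (hz' n.+1).
move=> i; rewrite ltnS leq_eqVlt /upd => /orP [/eqP ->|ltin]; first by rewrite eqxx.
by rewrite ltn_eqF // -ag //; apply: (za n).
Qed.

(* A point y = max (omega y) whose limit set has isolated minimum m is recurrent,
   so the orbit of y hits m twice and m is periodic; the tails of c approach m,
   from neither side properly, hence one of them equals m. *)
Theorem eventually_periodic p c : (forall i, c i < p)%N ->
  lex_wf [set z | exists e, z = shift e c] ->
  (forall m l, (0 < l)%N -> (forall i, m i < p)%N -> (forall i, m (l + i)%N = m i) ->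
     exists n0, forall e, agree n0 (shift e c) m -> ~ slt (shift e c) m) ->
  exists E T, (0 < T)%N /\ forall i, c (E + T + i)%N = c (E + i)%N.
Proof.
move=> hc wfc hper.
have wfo : lex_wf (omega c).
  move=> [u [hu hlt]]; apply: wfc.
  have [n hn] := choice (fun i => let: ex_intro2 n h h' := hlt i in
    ex_intro (fun n => agree n (u i.+1) (u i) /\ (u i.+1 n < u i n)%N) n (conj h h')).
  (* [u i] is compared with its successor at [n i] and with its predecessor at [n i.-1]; the tail
     approximating it must agree past both places. *)
  have [e he] := choice (fun i => let: ex_intro2 k _ h := hu i (n i + n i.-1).+1 0%N in
    ex_intro (fun k => agree (n i + n i.-1).+1 (shift k c) (u i)) k h).
  exists (fun i => shift (e i) c); split=> [i|i]; first by exists (e i).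
  have ag1 : agree (n i).+1 (shift (e i.+1) c) (u i.+1).
    by apply: agree_le (he i.+1); rewrite ltnS leq_addl.
  have ag2 : agree (n i).+1 (shift (e i) c) (u i).
    by apply: agree_le (he i); rewrite ltnS leq_addr.
  have [ag lt] := hn i; exists (n i); last by rewrite ag1 // ag2.
  apply: (agree_trans (agree_le (leqnSn _) ag1)).
  by apply: (agree_trans ag); apply/agree_sym/(agree_le (leqnSn _)).
have [z0 hz0 z0max] := omega_max hc.
have [||y [x [hx [hxy ymax]]] ymin] := @lex_wf_min (omega c)
  [set z | exists x, (x = c \/ omega c x) /\
     (omega x z /\ forall z', omega x z' -> ~ slt z z')] wfo.
- by move=> z [x [hx [hz _]]]; case: hx hz => [->|hx] //; apply: omega_trans.
- by exists z0, c; split=> //; left.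
have cy : omega c y by case: hx hxy => [->|hx] //; apply: omega_trans.
(* The maximum of [omega y] is again a candidate. Minimality of [y] among candidates and its
   maximality in [omega x] make the two equal. *)
have yy : omega y y.
  have [y' hy' y'max] := omega_max (omega_bound hc cy).
  have e : y' = y.
    apply: lex_total; first by apply: ymin; exists y; split; [right|].
    by apply: ymax; apply: omega_trans hy'.
  by rewrite -{2}e.
have [||m ym mmin] := @lex_wf_min (omega c) (omega y) wfo.
- by move=> z; apply: omega_trans.
- by exists y.
have cm := omega_trans cy ym.
have [n1 hn1] := lex_wf_isolated m wfo.
have hit k : agree n1 (shift k y) m -> shift k y = m.
  move=> ag; have yk := omega_shift k yy.
  by apply: lex_total; [exact: mmin|apply: hn1 => //; apply: omega_trans yk].
have [k1 _ /hit e1] := ym n1 0%N.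
have [k2 lt12 /hit e2] := ym n1 k1.+1.
have mper i : m (k2 - k1 + i)%N = m i.
  by rewrite -{1}e1 -e2 /shift addnA subnKC // ltnW.
have T0 : (0 < k2 - k1)%N by rewrite subn_gt0.
have [n0 hn0] := hper m _ T0 (omega_bound hc cm) mper.
have [n2 hn2] := lex_wf_isolated m wfc.
have [e _ ag] := cm (n0 + n2)%N 0%N.
have em : shift e c = m.
  apply: lex_total; first by apply: hn0; apply: agree_le ag; apply: leq_addr.
  by apply: hn2; [exists e|apply: agree_le ag; apply: leq_addl].
exists e, (k2 - k1)%N; split=> // i.
by rewrite -addnA -[LHS]/(shift e c _) em mper -em.
Qed.

Fixpoint num p a n := if n is n'.+1 then (p * num p a n' + a n')%N else 0%N.

Lemma num_agree p n a b : agree n a b -> num p a n = num p b n.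
Proof.
elim: n => [|n IHn] // h /=; rewrite h // IHn //; exact: agree_le h.
Qed.

Lemma num_slt p a b : (forall i, a i < p)%N -> slt a b ->
  (forall n, num p a n <= num p b n)%N /\
  exists n0, forall n, (n0 <= n)%N -> (num p a n < num p b n)%N.
Proof.
move=> ha [n0 ag lt].
have h n : (n0 < n)%N -> (num p a n < num p b n)%N.
  elim: n => // n IHn; rewrite ltnS leq_eqVlt => /orP [/eqP <-|/IHn {}IHn] /=.
    by rewrite (num_agree p ag) ltn_add2l.
  apply: leq_trans (leq_addr _ _); apply: leq_trans (_ : p * (num p a n).+1 <= _)%N.
    by rewrite mulnS addnC ltn_add2r.
  by rewrite leq_mul2l IHn orbT.
split; last by exists n0.+1.
move=> n; have [len|/h /ltnW //] := leqP n n0.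
by rewrite (num_agree p (agree_le len ag)).
Qed.

Lemma num_add p n k a : num p a (n + k) = (p ^ k * num p a n + num p (shift n a) k)%N.
Proof.
elim: k => [|k IHk]; first by rewrite addn0 expn0 mul1n addn0.
by rewrite addnS /= IHk mulnDr mulnA -expnS addnA.
Qed.

Lemma num_periodic p l a n : (forall i, a (l + i)%N = a i) ->
  num p a (l * n) = periodic_num (p ^ l) (num p a l) n.
Proof.
move=> ha; elim: n => [|n IHn]; first by rewrite muln0.
rewrite mulnS num_add (_ : shift l a = a); last exact: funext.
by rewrite IHn /= -expnM addnC.
Qed.

End Words.

(** * The base-p expansion attached to mu *)

Lemma frob_pow_idgen (A : comNzRingType) (p e : nat) (m : set A) xs z : p \in [pchar A] ->
  (forall y, m y <-> idgen xs y) ->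
  frob_pow m (p ^ e) z <-> idgen (fpow xs (p ^ e)) z.
Proof.
move=> hp hm; split.
  case=> n [c [r [mr ->]]]; elim/big_ind: _ => [|x y|i _].
  - exact: (ideal0 (idgen_ideal _)).
  - by apply: idealD; apply: idgen_ideal.
  - apply: (idealMl _ (idgen_ideal _)); rewrite -(frob_idgen hp); apply: frob_mem.
    exact/hm/mr.
have : forall x, x \in xs -> m x by move=> x xxs; apply/hm/idgen_mem.
rewrite /fpow; elim: {hm} xs z => [|x s IHs] z hs.
  move=> ->; exists 0%N, (fun=> 0), (fun=> 0); rewrite big_ord0; split=> //.
  by case.
case=> c0 [y [_ sy ->]].
have [|n [c [r [mr ey]]]] := IHs y _ sy; first by move=> w ws; apply: hs; rewrite inE ws orbT.
exists n.+1, (fun i => oapp c c0 (unlift ord0 i)), (fun i => oapp r x (unlift ord0 i)).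
split=> [i|]; first by case: unliftP => [j|] _ /=; [exact: mr|exact/hs/mem_head].
rewrite big_ord_recl unlift_none /= ey; congr (_ + _).
by apply: eq_bigr => j _; rewrite liftK.
Qed.

Section Digits.
Variables (S : comNzRingType) (p : nat) (ys : seq S).
Hypothesis hp : p \in [pchar S].
Hypothesis hN : noeth S.
Hypothesis hloc : locally_units ys.
Hypothesis m1 : ~ idgen ys 1.
Hypothesis hsoc : forall e, ~ idgen (fpow ys (p ^ e)) (\prod_(x <- ys) x ^+ (p ^ e).-1).
Hypothesis hc : adic_complete ys.
Variables (f : S) (mu : nat -> nat).
Hypothesis hmu : forall e k, idgen (fpow ys (p ^ e)) (f ^+ k) <-> (mu e <= k)%N.

Let p1 : (1 < p)%N. Proof. by rewrite prime_gt1 // (pcharf_prime hp). Qed.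

Lemma mu_gt0 e : (0 < mu e)%N.
Proof.
rewrite lt0n; apply/eqP => mu0; have /hmu : (mu e <= 0)%N by rewrite mu0.
rewrite expr0 => h; apply: m1; apply: idgen_sub h; first exact: idgen_ideal.
move=> _ /mapP [x xys ->]; rewrite -(prednK (frob_gt0 hp e)) exprS.
by apply: (idealMr _ (idgen_ideal _)); apply: idgen_mem.
Qed.

Let nu e := (mu e).-1.
Let J e := colon (idgen (fpow ys (p ^ e))) (f ^+ nu e).
Let c e := (nu e.+1 - p * nu e)%N.

Let muE e : mu e = (nu e).+1. Proof. by rewrite prednK // mu_gt0. Qed.

Let primary_J e : primary ys (J e).
Proof. by apply: primary_colon; apply: primary_fpow. Qed.

Let fpow_frob e n : idgen (fpow ys (p ^ (e + n))) = frob (p ^ n) (idgen (fpow ys (p ^ e))).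
Proof.
rewrite (frob_idgen hp) /fpow -map_comp; congr idgen; apply: eq_map => x /=.
by rewrite -exprM -expnD.
Qed.

Let frob_J e n k : frob (p ^ n) (J e) (f ^+ k) <-> (mu (e + n) <= k + p ^ n * nu e)%N.
Proof.
rewrite -hmu exprD (mulnC (p ^ n)%N) exprM fpow_frob.
split=> h; first exact: (frob_colon_sub (idgen_ideal _) h).
exact: (frob_colon hp hN hloc hsoc (primary_fpow _ _) h).
Qed.

(** The truncated difference [c e] is a true one: if p nu(e) exceeded nu(e+1), then 1 would lie in
    J_e^[p], hence in J_e, against the minimality of mu(e). *)
Let nuS e : nu e.+1 = (p * nu e + c e)%N.
Proof.
rewrite /c subnKC // leqNgt; apply/negP => lt.
have : frob (p ^ 1) (J e) (f ^+ 0) by apply/frob_J; rewrite addn1 muE add0n expn1.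
rewrite expr0 => h; have : J e 1.
  apply: frob_sub h => [|r Jr]; first by case: (primary_J e).
  by rewrite -(prednK (frob_gt0 hp 1)) exprS; apply: idealMr => //; case: (primary_J e).
by rewrite /J /colon mul1r => /hmu; rewrite muE ltnn.
Qed.

Let c_lt e : (c e < p)%N.
Proof.
have : (mu e.+1 <= mu e * p)%N.
  apply/hmu; rewrite -addn1 fpow_frob exprM -[X in _ ^+ X]expn1.
  by apply: frob_mem; apply/hmu.
by rewrite !muE nuS mulSn mulnC; lia.
Qed.

Let nuD e n : nu (e + n) = (p ^ n * nu e + num p (shift e c) n)%N.
Proof.
elim: n => [|n IHn]; first by rewrite addn0 expn0 mul1n addn0.
by rewrite addnS nuS IHn /= mulnDr mulnA -expnS addnA.
Qed.

Let frob_num e n k : frob (p ^ n) (J e) (f ^+ k) <-> (num p (shift e c) n < k)%N.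
Proof.
rewrite frob_J muE nuD.
by split; lia.
Qed.

Let digits_wf : lex_wf [set z | exists e, z = shift e c].
Proof.
move=> [u [hu hlt]]; have [e he] := choice hu.
have hub i j : (u i j < p)%N by rewrite he; apply: c_lt.
have hnum i := num_slt (hub i.+1) (hlt i).
apply: (@threshold_wf _ _ hp _ hN hloc hsoc hc f (fun i n => num p (u i) n) (fun i => J (e i))).
- by move=> i; apply: primary_J.
- by move=> i n k; rewrite frob_num he.
- by move=> i n; apply: (hnum i).1.
- by move=> i; have [n0 hn0] := (hnum i).2; exists n0; apply: hn0.
Qed.

(** For a tail below [m], the power of f given by n periods lies in the Frobenius power of J_e for
    all large n. By [hsl_stable] this already holds at a fixed n0, impossible for a tail agreeing
    with [m] on n0 periods. *)
Let digits_not_below m l : (0 < l)%N -> (forall i, m i < p)%N ->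
  (forall i, m (l + i)%N = m i) ->
  exists n0, forall e, agree n0 (shift e c) m -> ~ slt (shift e c) m.
Proof.
move=> l0 hm hper.
have [n0 hn0] := hsl_stable hp hN hloc hsoc hc f (num p m l) l0.
exists (l * n0)%N => e ag lt.
have [_ [n1 hn1]] := num_slt (fun i => c_lt (e + i)) lt.
have := hn0 n1 (J e) (primary_J e); rewrite -!num_periodic // => h.
have /h /frob_num : frob (p ^ (l * n1)) (J e) (f ^+ num p m (l * n1)).
  by apply/frob_num/hn1; rewrite leq_pmull.
by rewrite (num_agree p ag) ltnn.
Qed.

Theorem mu_digits : exists c : nat -> nat,
  [/\ forall e, (mu e.+1).-1 = (p * (mu e).-1 + c e)%N, forall e, (c e < p)%N &
   exists E T, (0 < T)%N /\ forall i, c (E + T + i)%N = c (E + i)%N].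
Proof.
exists c; split=> //.
exact: (eventually_periodic c_lt digits_wf digits_not_below).
Qed.

End Digits.

(** * Regular local rings and passage to the completion *)

Section RegularLocal.
Variables (A : comNzRingType) (m : set A).
Hypothesis hreg : is_regular_local_ring m.

Lemma regular_parameters : exists xs,
  [/\ forall z, m z <-> idgen xs z, locally_units xs, ~ idgen xs 1 &
   forall q, (0 < q)%N -> ~ idgen (fpow xs q) (\prod_(x <- xs) x ^+ q.-1)].
Proof.
have [hnoeth [hlocal [d [[[P [hprime hstrict]] _] [g hg]]]]] := hreg.
have hN := noetherian_noeth hnoeth.
have [hm hloc] := is_local_units hN hlocal.
have im := prime_ideal hm.
pose xs := [seq g i | i <- enum 'I_d].
have hxs z : m z <-> idgen xs z.
  split; last first.
    apply: idgen_sub => // _ /mapP [i _ ->]; apply/hg.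
    exists (fun j => (j == i)%:R); rewrite (bigD1 i) //= eqxx mul1r big1 ?addr0 //.
    by move=> j /negPf ->; rewrite mul0r.
  move=> /hg [c ->]; elim/big_ind: _ => [|x y|i _].
  - exact: (ideal0 (idgen_ideal _)).
  - by apply: idealD; apply: idgen_ideal.
  - apply: (idealMl _ (idgen_ideal _)); apply/idgen_mem/map_f.
    by rewrite mem_enum.
have szxs : size xs = d by rewrite size_map size_enum_ord.
(* The chain of length [d] is not given as ending at [m]; putting [m] at its top keeps the
   inclusions strict. *)
pose P' i := if i == d then m else P i.
have prime_sub Q : is_prime_ideal Q -> Q `<=` m.
  move=> hQ z Qz; apply: contrapT => /hloc [b hb]; apply: (prime_not1 hQ).
  by rewrite -hb; apply: idealMl => //; apply: prime_ideal.
have hP' : pchain (size xs) P'.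
  rewrite szxs; split=> i lei; rewrite /P'; first by case: eqP => // _; apply: hprime.
  rewrite (ltn_eqF lei); have [sub [x [Px nPx]]] := hstrict i lei.
  have [ei|_] := eqP; last by split=> // /(_ _ Px).
  split; first by apply: prime_sub; apply: hprime; apply: ltnW.
  by move=> /(_ x (prime_sub _ (hprime i.+1 lei) _ Px)).
have P'm : P' (size xs) = m by rewrite /P' szxs eqxx.
have P'0 : P' 0%N 0 by apply: ideal0; apply: prime_ideal; apply: hP'.1.
exists xs; split=> //.
- by move=> a na; apply: hloc => /hxs.
- by move=> /hxs; apply: prime_not1.
- by move=> q q0; apply: (socle_notin hN hloc hm hxs hP' P'm P'0 q0).
Qed.

Theorem mu_eventually_periodic (p : nat) (f : A) (mu : nat -> nat) :
  p \in [pchar A] -> f != 0 -> (forall e, is_mu m f (p ^ e) (mu e)) ->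
  (forall e, (0 < mu e)%N) /\ (exists e, (1 < mu e)%N) /\
  exists c : nat -> nat,
  [/\ forall e, (mu e.+1).-1 = (p * (mu e).-1 + c e)%N, forall e, (c e < p)%N &
   exists E T, (0 < T)%N /\ forall i, c (E + T + i)%N = c (E + i)%N].
Proof.
move=> hp f0 hmu.
have [hnoeth [hlocal _]] := hreg; have hN := noetherian_noeth hnoeth.
have [hm hloc] := is_local_units hN hlocal.
have [xs [hxs hu m1 hsoc]] := regular_parameters.
have [S [i [[]]]] := completion m1 hu; set ys := map i xs => m1S huS hcS hsS [hd hi].
have hNS := complete_noeth huS hcS hsS.
have hpS : p \in [pchar S] by apply: (rmorph_pchar i).
(* Coefficients in [S] are approximated by elements of [A] modulo the N-th power of the maximal
   ideal, with N such that m^N lies in m^[q]. *)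
have transfer q z : idgen (fpow ys q) (i z) -> idgen (fpow xs q) z.
  move=> h; have [N hNq] := mpow_sub_powers xs q.
  suff [w sw hw] : exists2 w, idgen (fpow xs q) w & mpow ys N (i z - i w).
    rewrite -(subrK w z); apply: (idealD (idgen_ideal _)) => //.
    by apply/hNq/hi; rewrite rmorphB.
  have approx s w : idgen [seq i x | x <- s] w -> exists2 v, idgen s v & mpow ys N (w - i v).
    elim: s w => [|x s IHs] w; first by move=> ->; exists 0; rewrite // rmorph0 subrr;
      apply: mpow0.
    case=> c [y [_ /IHs [v sv hv] ->]]; have [c' hc'] := hd N c.
    exists (c' * x + v); first by exists c', v.
    have -> : c * i x + y - i (c' * x + v) = i x * (c - i c') + (y - i v).
      by rewrite rmorphD rmorphM; ring.
    by apply: (idealD (mpow_ideal _ _)) => //; apply: (idealMl _ (mpow_ideal _ _)).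
  apply: approx; move: h; rewrite /fpow /ys -!map_comp; congr (idgen _ _).
  by apply: eq_map => x /=; rewrite rmorphXn.
have fwd q z : idgen (fpow xs q) z -> idgen (fpow ys q) (i z).
  apply: (idgen_sub (J := fun z => idgen (fpow ys q) (i z))).
    split; first by rewrite rmorph0; apply: (ideal0 (idgen_ideal _)).
    split=> [x y hx hy|a x hx]; first by rewrite rmorphD; apply: (idealD (idgen_ideal _)).
    by rewrite rmorphM; apply: (idealMl _ (idgen_ideal _)).
  move=> _ /mapP [x xxs ->]; rewrite rmorphXn; apply: idgen_mem.
  by apply: map_f; apply: map_f.
have hsocS e : ~ idgen (fpow ys (p ^ e)) (\prod_(x <- ys) x ^+ (p ^ e).-1).
  have -> : \prod_(x <- ys) x ^+ (p ^ e).-1 = i (\prod_(x <- xs) x ^+ (p ^ e).-1).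
    by rewrite big_map rmorph_prod; apply: eq_bigr => x _; rewrite rmorphXn.
  by move=> /transfer; apply: hsoc; rewrite (frob_gt0 hp).
have muP e k : idgen (fpow xs (p ^ e)) (f ^+ k) <-> (mu e <= k)%N.
  have [hin hmin] := hmu e; split=> [h|le].
    by apply: hmin; apply/(frob_pow_idgen e _ hp hxs).
  rewrite -(subnK le) exprD; apply: (idealMl _ (idgen_ideal _)).
  exact/(frob_pow_idgen e _ hp hxs).
have hmuS e k : idgen (fpow ys (p ^ e)) (i f ^+ k) <-> (mu e <= k)%N.
  by rewrite -muP -rmorphXn; split; [apply: transfer|apply: fwd].
split; first exact: (mu_gt0 hpS m1S hmuS).
split; last exact: (mu_digits hpS hNS huS m1S hsocS hcS hmuS).
(* If mu never exceeded 1, f would lie in every m^[p^n], hence, as p^n >= n, in every ideal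
   generated by the n-th powers of the parameters. *)
apply: contrapT => hno; move/eqP: f0; apply.
apply: (krull_intersection hN hloc hm hxs) => n.
have p1 : (1 < p)%N by rewrite prime_gt1 // (pcharf_prime hp).
have : idgen (fpow xs (p ^ n)) (f ^+ 1).
  by apply/muP; rewrite leqNgt; apply/negP => h; apply: hno; exists n.
rewrite expr1; apply: idgen_sub; first exact: idgen_ideal.
move=> _ /mapP [x xxs ->]; rewrite -(subnK (ltnW (ltn_expl n p1))) exprD.
apply: (idealMl _ (idgen_ideal _)); apply: idgen_mem; exact: (map_f (fun x => x ^+ n)).
Qed.

End RegularLocal.

(** * The generating function *)

Section GeneratingFunction.
Variables (RR : realType) (p : nat) (mu c : nat -> nat) (E T : nat).
Hypothesis p1 : (1 < p)%N.
Hypothesis mu0 : forall e, (0 < mu e)%N.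
Hypothesis muS : forall e, (mu e.+1).-1 = (p * (mu e).-1 + c e)%N.
Hypothesis c_lt : forall e, (c e < p)%N.
Hypothesis T0 : (0 < T)%N.
Hypothesis cT : forall i, c (E + T + i)%N = c (E + i)%N.
Hypothesis mu1 : exists e, (1 < mu e)%N.

Let x : RR := p%:R^-1.
Let B : {poly RR} := 1 - 'X^T.
Let Q := (1 - p%:R *: 'X) * B.
Let D := (E + T).+1.
Let g n : RR := \sum_(i < n.+1) Q`_i * (mu (n - i)%N)%:R.
Let P : {poly RR} := \poly_(n < D) g n.
(** Coefficients of [B] times the generating function; [g] includes the factor 1 - pX as well. *)
Let h n : RR := (mu n)%:R - (if (n < T)%N then 0 else (mu (n - T)%N)%:R).
Let u n : RR := (mu n)%:R / (p ^ n)%:R.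

Let pR0 : (0 : RR) < p%:R. Proof. by rewrite ltr0n ltnW. Qed.
Let px : p%:R * x = 1. Proof. by rewrite mulfV // gt_eqF. Qed.
Let x0 : 0 < x. Proof. by rewrite invr_gt0. Qed.
Let x1 : x < 1. Proof. by rewrite invf_lt1 // ltr1n. Qed.
Let uE n : u n = (mu n)%:R * x ^+ n.
Proof. by rewrite /u natrX exprVn. Qed.

Let muE e : mu e.+1 = (p * (mu e).-1 + c e).+1.
Proof. by rewrite -muS prednK // mu0. Qed.

Let gE n : g n = h n - p%:R * (if n == 0%N then 0 else h n.-1).
Proof.
pose M : {poly RR} := \poly_(j < n.+1) (mu j)%:R.
have hM k : (k <= n)%N -> (B * M)`_k = h k.
  move=> lek; rewrite mulrBl mul1r coefB coefXnM !coef_poly ltnS lek /h.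
  by rewrite (leq_ltn_trans (leq_subr T k)).
have -> : g n = (Q * M)`_n.
  rewrite coefM; apply: eq_bigr => i _; rewrite coef_poly ltnS leq_subr //.
rewrite -mulrA mulrBl mul1r -scalerAl coefB coefZ coefXM hM //.
by case: eqP => // /eqP n0; rewrite hM ?leq_pred.
Qed.

(** The quantity mu(e+1) - p mu(e) = c(e) + 1 - p has period T from [E] on, so the factor 1 - X^T
    kills it for e >= E + T. It sits at index e + 1, whence the extra 1 in [D]. *)
Let g0 n : (D <= n)%N -> g n = 0.
Proof.
case: n => // n; rewrite ltnS => len.
have nT : (T <= n)%N by apply: leq_trans len; apply: leq_addl.
rewrite gE /= /h (ltnNge n T) nT (ltnNge n.+1 T) (leqW nT) /= subSn //.
rewrite muE (muE (n - T)%N).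
have -> : c n = c (n - T)%N.
  have := cT (n - (E + T))%N; rewrite subnKC // => ->.
  by congr c; lia.
have /prednK <- := mu0 n; have /prednK <- := mu0 (n - T)%N.
rewrite -!natr1 !natrD !natrM /=; ring.
Qed.

(** The sum telescopes because p x = 1. As [g] vanishes from [D] on, P(1/p) equals h(n) x^n for
    every large n, so its value can be found by letting n grow. *)
Let sum_g n : \sum_(j < n.+1) g j * x ^+ j = h n * x ^+ n.
Proof.
elim: n => [|n IHn]; first by rewrite big_ord1 gE eqxx mulr0 subr0.
rewrite big_ord_recr IHn [val _]/= gE [n.+1 == 0%N]/= [n.+1.-1]/=.
have -> : (h n.+1 - p%:R * h n) * x ^+ n.+1 =
    h n.+1 * x ^+ n.+1 - (p%:R * x) * (h n * x ^+ n) by rewrite exprS; ring.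
by rewrite px mul1r [LHS]addrC subrK.
Qed.

Let PxE n : (D <= n)%N -> P.[x] = h n * x ^+ n.
Proof.
move=> leDn; rewrite -sum_g horner_poly.
rewrite -(big_mkord predT (fun i => g i * x ^+ i)) -(big_mkord predT (fun i => g i * x ^+ i)).
rewrite [RHS](@big_cat_nat _ _ _ D) //=; last exact: leqW.
rewrite [X in _ + X]big_nat_cond [X in _ + X]big1 ?addr0 // => i /andP [/andP [lei _] _].
by rewrite g0 // mul0r.
Qed.

Let PxE' n : P.[x] = u (n + D)%N - x ^+ T * u (n + D - T)%N.
Proof.
have leT : (T <= n + D)%N by rewrite /D; lia.
rewrite (@PxE (n + D)) ?leq_addl // /h ltnNge leT /= mulrBl !uE; congr (_ - _).
by rewrite mulrCA -exprD subnKC.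
Qed.

Let u_nonincr : nonincreasing_seq u.
Proof.
apply/nonincreasing_seqP => n; rewrite !uE exprS mulrA ler_pM2r ?exprn_gt0 //.
rewrite ler_pdivrMr // -natrM ler_nat muE.
by have := c_lt n; have := mu0 n; case: (mu n) => // k _ /=; rewrite mulSn mulnC; lia.
Qed.

Let u_cvg : cvgn u.
Proof.
apply: nonincreasing_is_cvgn => //; exists 0 => _ [n _ <-].
by rewrite divr_ge0.
Qed.

Let l : RR := limn u.

(** The lower bounds (mu(e) - 1)/p^e do not decrease, the digits being non-negative, and are
    positive once mu(e) > 1. *)
Let l_gt0 : 0 < l.
Proof.
have [e he] := mu1; pose v : RR := ((mu e).-1)%:R * x ^+ e.
have v0 : 0 < v by rewrite mulr_gt0 ?exprn_gt0 // ltr0n -subn1 subn_gt0.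
apply: lt_le_trans v0 _; apply: limr_ge => //.
exists e => // n /= len; rewrite -(subnKC len).
suff hk k : v <= ((mu (e + k)).-1)%:R * x ^+ (e + k).
  apply: le_trans (hk (n - e)%N) _; rewrite uE; apply: ler_wpM2r.
    by rewrite exprn_ge0 // ltW.
  by rewrite ler_nat leq_pred.
elim: k => [|k IHk]; first by rewrite addn0.
apply: le_trans IHk _; rewrite addnS muS exprS mulrA ler_pM2r ?exprn_gt0 //.
by rewrite ler_pdivlMr // -natrM ler_nat mulnC leq_addr.
Qed.

Let Bx : B.[x] = 1 - x ^+ T.
Proof. by rewrite !hornerE. Qed.

Let Bx0 : B.[x] != 0.
Proof.
rewrite Bx subr_eq0 eq_sym lt_eqF // exprn_ilt1 ?ltW //.
by rewrite -lt0n.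
Qed.

Let Px : P.[x] = B.[x] * l.
Proof.
have hl1 : (fun n => u (n + D)%N) @ \oo --> l by rewrite (cvg_shiftn D).
have hl2 : (fun n => u (n + D - T)%N) @ \oo --> l.
  rewrite (_ : (fun n => _) = (fun n => u (n + (D - T))%N));
    first by rewrite (cvg_shiftn (D - T)).
  by apply: funext => n; rewrite addnBA // /D; lia.
have : (fun n => u (n + D)%N - x ^+ T * u (n + D - T)%N) @ \oo --> l - x ^+ T * l.
  by apply: cvgB => //; apply: cvgM => //; apply: cvg_cst.
rewrite (_ : (fun n => _) = (fun=> P.[x])); last by apply: funext => n; rewrite -PxE'.
move=> /(cvg_unique _) /(_ (cvg_cst _)) e.
by rewrite -e // Bx mulrBl mul1r.
Qed.

(** Rationality is the power series identity Q G = P, with Q invertible because Q(0) = B(0) is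
    nonzero. The pole at 1/p is exactly simple since neither B nor P vanishes there. *)
Theorem rational_generating_function : exists (P B : {poly RR}),
  let Q := (1 - p%:R *: 'X) * B in
  B.[0] != 0 /\ B.[p%:R^-1] != 0 /\ P.[p%:R^-1] != 0 /\
  (forall n, \sum_(i < n.+1) Q`_i * (mu (n - i)%N)%:R = P`_n) /\
  (fun z : RR => (1 - p%:R * z) * (P.[z] / Q.[z])) @ (p%:R^-1 : RR)^' --> fpt RR p mu.
Proof.
exists P, B => /=; split; first by rewrite !hornerE expr0n gtn_eqF // subr0 oner_neq0.
split; first exact: Bx0.
split; first by rewrite -/x Px mulf_neq0 // gt_eqF.
split=> [n|].
  rewrite -/(g n) coef_poly; case: ltnP => // /g0 //.
have -> : fpt RR p mu = P.[x] / B.[x] by rewrite Px mulrC mulKf.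
have : (fun z : RR => P.[z] / B.[z]) @ x^' --> P.[x] / B.[x].
  apply: cvgM; last apply: cvgV => //.
    by apply: cvg_within_filter; apply: continuous_horner.
  by apply: cvg_within_filter; apply: continuous_horner.
apply: cvg_trans; apply: near_eq_cvg.
near=> z.
have zx : z != x by near: z; apply: nbhs_dnbhs_neq.
have wE : (1 - p%:R *: 'X).[z] = 1 - p%:R * z by rewrite !hornerE.
have w0 : 1 - p%:R * z != 0.
  rewrite subr_eq0; apply: contraNneq zx => e.
  by rewrite -[z]mul1r -(mulVf (lt0r_neq0 pR0)) -mulrA -e mulr1.
by rewrite hornerM wE; set w := 1 - _ in w0 *;
  rewrite [RHS]mulrCA invfM (mulrA w) mulfV // mul1r.
Unshelve. all: by end_near.
Qed.

End GeneratingFunction.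

Theorem theorem2p3 (A : comNzRingType) (m : A -> Prop) (p : nat)
  (RR : realType) (f : A) (mu : nat -> nat) :
  prime p -> p \in [pchar A] ->
  is_regular_local_ring m ->
  m f -> f != 0 ->
  (forall e, is_mu m f (p ^ e) (mu e)) ->
  exists (P B : {poly RR}),
    let Q := (1 - p%:R *: 'X) * B in
    B.[0] != 0 /\ B.[p%:R^-1] != 0 /\ P.[p%:R^-1] != 0 /\
    (forall n, \sum_(i < n.+1) Q`_i * (mu (n - i)%N)%:R = P`_n) /\
    (fun z : RR => (1 - p%:R * z) * (P.[z] / Q.[z])) @ (p%:R^-1 : RR)^'
      --> fpt RR p mu.
Proof.
move=> hpr hp hreg _ f0 hmu.
have [mu_gt [mu_gt1 [c [muS c_lt [E [T [T0 cT]]]]]]] := mu_eventually_periodic hreg hp f0 hmu.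
exact: (rational_generating_function RR (prime_gt1 hpr) mu_gt muS c_lt T0 cT mu_gt1).
Qed.
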